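(* Let $X_0(\beta_i), X_F(\beta_i)\in\mathbb{R}^n$, $i=1,\ldots,N$, be initial and target states of the sampled linear ensemble system $$\frac{d}{dt}X(t,\beta_i)=A(t,\beta_i)X(t,\beta_i)+B(t,\beta_i)u(t),\qquad i=1,\ldots,N,\ t\in[0,T],$$ where each individual system (indexed by $\beta_i$) is controllable on $[0,T]$. Let $G\subset L^2([0,T],\mathbb{R}^m)$ be a closed convex set (the set of constraints on the control input), with projection operator $P_G$, and let $C_i=\{u\in L^2([0,T],\mathbb{R}^m): L_iu=\xi_i\}$. Let $\lambda_0,\ldots,\lambda_N\in(0,1)$ with $\sum_{i=0}^N\lambda_i=1$. If $\big(\bigcap_{i=1}^N C_i\big)\cap G\neq\emptyset$, then for any initial $u^{(0)}\in L^2([0,T],\mathbb{R}^m)$ the sequence generated by $$u^{(k+1)}=\lambda_0P_Gu^{(k)}+\sum_{i=1}^N\lambda_i\big[(I_d-L_i^*(L_iL_i^* )^{-1}L_i)u^{(k)}+L_i^*(L_iL_i^* )^{-1}\xi_i\big],\qquad k=0,1,2,\ldots,$$ converges weakly to a feasible constrained ensemble control, i.e. to a point of $\big(\bigcap_{i=1}^N C_i\big)\cap G$.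
   Context: Setting: $T\in(0,\infty)$ is fixed; $\beta_1,\ldots,\beta_N$ are parameter values in a compact set $K\subset\mathbb{R}$; for each $i$, $A(\cdot,\beta_i)\in L^\infty([0,T],\mathbb{R}^{n\times n})$ and $B(\cdot,\beta_i)\in L^2([0,T],\mathbb{R}^{n\times m})$; the same control $u\in L^2([0,T],\mathbb{R}^m)$ is applied to all $N$ systems, and $X(t,\beta_i)\in\mathbb{R}^n$. $\Phi(t,s,\beta_i)$ is the transition matrix of the $i$-th system: $\frac{\partial}{\partial t}\Phi(t,s,\beta_i)=A(t,\beta_i)\Phi(t,s,\beta_i)$ (for a.e. $t$), $\Phi(s,s,\beta_i)=I$. The bounded linear operator $L_i:L^2([0,T],\mathbb{R}^m)\to\mathbb{R}^n$ is $L_i(u)=\int_0^T\Phi(T,\sigma,\beta_i)B(\sigma,\beta_i)u(\sigma)\,d\sigma$, $L_i^*$ is its adjoint, and $\xi_i=X_F(\beta_i)-\Phi(T,0,\beta_i)X_0(\beta_i)\in\mathbb{R}^n$. $I_d$ is the identity operator on $L^2([0,T],\mathbb{R}^m)$. Controllability of the $i$-th system means that $L_i$ has range $\mathbb{R}^n$, equivalently that $L_iL_i^*$ is invertible. $P_Gu$ denotes the unique point of $G$ closest to $u$ in the $L^2$ norm. *)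

(* Defs.v *)
From mathcomp Require Import all_boot all_order all_algebra.
From mathcomp Require Import all_classical all_reals all_analysis.
Set Implicit Arguments.
Unset Strict Implicit.
Unset Printing Implicit Defensive.
Import Order.TTheory GRing.Theory Num.Theory.
Import numFieldNormedType.Exports.
Local Open Scope classical_set_scope.
Local Open Scope ring_scope.

Section TimeInterval.
Variables (R : realType) (T : R).

Definition time_measure : {measure set (measurableTypeR R) -> \bar R} :=
  mrestr lebesgue_measure (measurable_itv `[0, T]).

(* L^2([0,T],R^m).  As with the library's LfunType, elements are
   square-integrable functions, not classes modulo equality almost everywhere:
   the quantities below depend only on the class, and an L2closed set is
   automatically a union of classes.  Functions on [0,T] are represented by
   measurable functions on R, whose values outside [0,T] are irrelevant since
   the measure is carried by [0,T]. *)
Definition L2 (m : nat) := {ffun 'I_m -> LfunType time_measure (lee1n 2)}.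

Definition L2val m (u : L2 m) (t : R) : 'cV[R]_m := \col_j u j t.

Definition L2dot m (u v : L2 m) : R :=
  \int[time_measure]_t ((L2val u t)^T *m L2val v t) 0 0.

Definition L2norm m (u : L2 m) : R := Num.sqrt (L2dot u u).

Definition L2closed m (G : set (L2 m)) : Prop :=
  forall u, (forall e, 0 < e -> exists2 g, G g & L2norm (u - g) < e) -> G u.

Definition L2weak_cvg m (u : nat -> L2 m) (l : L2 m) : Prop :=
  forall v, (fun k => L2dot (u k) v) @ \oo --> L2dot l v.

(* The metric projection P_G, unique up to equality almost everywhere when G is
   nonempty, closed and convex. *)
Definition L2proj m (G : set (L2 m)) (u : L2 m) : L2 m :=
  xget 0 [set p | G p /\ forall g, G g -> L2norm (u - p) <= L2norm (u - g)].

(* The adjoint L^* : R^n -> L^2 of L : L^2 -> R^n. *)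
Definition adjoint m n (L : L2 m -> 'cV[R]_n) (y : 'cV[R]_n) : L2 m :=
  xget 0 [set v | forall u, ((L u)^T *m y) 0 0 = L2dot u v].

Definition abs_continuous (f : R -> R) : Prop :=
  forall e, 0 < e -> exists2 d, 0 < d &
    forall (k : nat) (a b : 'I_k -> R),
      (forall i, 0 <= a i /\ a i <= b i /\ b i <= T) ->
      trivIset setT (fun i => `]a i, b i[%classic) ->
      \sum_i (b i - a i) < d -> \sum_i `|f (b i) - f (a i)| < e.

Definition Linfty_mx n p (M : R -> 'M[R]_(n, p)) : Prop :=
  forall i j, (fun t => M t i j : R) \in Lfun time_measure +oo.

Definition L2_mx n p (M : R -> 'M[R]_(n, p)) : Prop :=
  forall i j, (fun t => M t i j : R) \in Lfun time_measure 2%:E.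

(* Solutions of the equation with merely measurable A are taken in the sense of
   Caratheodory: absolutely continuous, satisfying the equation almost
   everywhere. *)
Definition transition_matrix n (A : R -> 'M[R]_n) (Phi : R -> R -> 'M[R]_n)
    : Prop :=
  forall s : R, 0 <= s <= T ->
    [/\ Phi s s = 1%:M,
        forall i j, abs_continuous (fun t => Phi t s i j) &
        {ae time_measure, forall t, forall i j,
          is_derive (t : R) (1 : R) (fun r : R => Phi r s i j) ((A t *m Phi t s) i j)}].

(* The domain is written out because Phi T s is constrained only for s in
   [0,T]. *)
Definition input_map n m (Phi : R -> R -> 'M[R]_n) (B : R -> 'M[R]_(n, m))
    (u : L2 m) : 'cV[R]_n :=
  \col_j \int[time_measure]_(s in `[0, T]) (Phi T s *m B s *m L2val u s) j 0.

(* Controllability on [0,T] of the system whose input map is L. *)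
Definition controllable n m (L : L2 m -> 'cV[R]_n) : Prop :=
  range L = [set: 'cV[R]_n].

(* (L L^* )^{-1}; pinv is the inverse function since L L^* is bijective when L
   has full range. *)
Definition gram_inv n m (L : L2 m -> 'cV[R]_n) : 'cV[R]_n -> 'cV[R]_n :=
  'pinv_(fun=> 0) setT (L \o adjoint L).

End TimeInterval.

(* Main.v *)
Require Import Defs.
From mathcomp Require Import all_boot all_order all_algebra.
From mathcomp Require Import all_classical all_reals all_analysis.
From mathcomp Require Import measurable_realfun ess_sup_inf ring lra.
Set Implicit Arguments.
Unset Strict Implicit.
Unset Printing Implicit Defensive.
Import Order.TTheory GRing.Theory Num.Theory.
Import numFieldNormedType.Exports.
Local Open Scope classical_set_scope.
Local Open Scope ring_scope.

(** The iteration averages, with positive weights, the metric projections onto the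
    closed convex sets G, C_1, ..., C_N, so the statement is an instance of the
    weak convergence of averaged projections in a Hilbert space.

    That theorem, averaged_projections_weak_cvg, uses three facts. The squared
    distance from the iterates to any common point z decreases, by at least the
    weighted squared displacements (fejer); hence the displacements tend to 0. A
    weak cluster point of the iterates therefore belongs to every set
    (weak_cluster_in), by the variational inequality of the projections. Finally
    two weak cluster points coincide by Opial's argument, because the distances to
    both of them converge. Weak cluster points are taken along ultrafilters on
    the indices: the pairings with the iterates then converge to a bounded linear
    form, and the Riesz theorem represents it. The Riesz theorem and the existence
    of projections are two cases of the minimization of a quadratic energy over a
    convex set (energy_minimizer), for which completeness of the space is needed;
    completeness of L^2 is L2s_complete. Everything is done for a positive
    semidefinite pairing, since functions equal almost everywhere are distinct.

    It remains to see that the affine steps are the projections onto the C_i. The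
    map L_i is integration against the rows of Phi(T, s) B(s), and these must be
    shown to be square integrable in s, although the differential equation only
    concerns the first argument of Phi. The function s |-> Phi(T, s) is Lipschitz
    (transition_lipschitz): solutions started at nearby times stay close, by
    Gronwall's inequality for absolutely continuous functions, itself a
    consequence of the mean value inequality under an almost-everywhere bound on the
    derivative (ac_increment_le). Controllability makes the Gram matrix L_i L_i^*
    invertible (gram_invK), and the corrected control then lies in C_i, at the end
    of a displacement orthogonal to the directions of C_i. *)

(** * Absolutely continuous functions and Gronwall's inequality *)

(** Straddling the point c matters: a one-point difference quotient bound holds on
    both sides of c, so increments over any short interval containing c inherit
    it, which is what lets the supremum argument below cross the point c. *)
Lemma derive_local_le (R : realType) (f : R -> R) (c d e : R) :
  is_derive c (1 : R) f d -> 0 < e -> exists2 r, 0 < r &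
    forall x y, c - r < x -> x <= c -> c <= y -> y < c + r ->
      f y - f x <= (d + e) * (y - x).
Proof.
move=> [df dE] e0.
have cv : h^-1 *: (f (h *: 1 + c) - f c) @[h --> 0^'] --> d.
  by rewrite -dE; exact: df.
have /cvgr_dist_lt/(_ e e0) := cv.
case=> r /= r0 rP.
exists r => // x y cx xc cy yc.
have key h : h != 0 -> `|h| < r -> `|d - h^-1 * (f (h + c) - f c)| < e.
  move=> h0 hr; have := rP h; rewrite /ball_ /= sub0r normrN => /(_ hr h0).
  by rewrite /GRing.scale /= mulr1.
have right : f y - f c <= (d + e) * (y - c).
  have [->|yc'] := eqVneq y c; first by rewrite !subrr mulr0.
  have h0 : 0 < y - c by rewrite subr_gt0 lt_neqAle eq_sym yc' cy.
  have := key (y - c) (lt0r_neq0 h0); rewrite gtr0_norm// subrK.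
  rewrite ltrBlDl => /(_ yc)/ltW; rewrite ler_norml => /andP[+ _].
  set q := _^-1 * _ => H.
  have -> : f y - f c = q * (y - c) by rewrite /q; field; lra.
  by rewrite ler_wpM2r ?subr_ge0//; lra.
have left : f c - f x <= (d + e) * (c - x).
  have [->|xc'] := eqVneq x c; first by rewrite !subrr mulr0.
  have h0 : x - c < 0 by rewrite subr_lt0 lt_neqAle xc' xc.
  have := key (x - c) (ltr0_neq0 h0); rewrite ltr0_norm// opprB subrK.
  rewrite ltrBlDl -ltrBlDr => /(_ cx)/ltW; rewrite ler_norml => /andP[+ _].
  set q := _^-1 * _ => H.
  have -> : f c - f x = q * (c - x) by rewrite /q; field; lra.
  by rewrite ler_wpM2r ?subr_ge0//; lra.
by nra.
Qed.

Section AbsoluteContinuity.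
Variables (R : realType) (T : R).
Local Notation AC := (abs_continuous T).

(** Non-overlapping intervals of [a, x] inside the open set U: absolute continuity
    controls the total increment of a function over such a family by the
    measure of U. *)
Definition intervals_in (U : set R) a x k (p q : 'I_k -> R) :=
  (forall i, [/\ a <= p i, p i <= q i, q i <= x & `[p i, q i] `<=` U]) /\
  trivIset setT (fun i => `]p i, q i[%classic).

Lemma intervals_in_cons (U : set R) a x y k (p q : 'I_k -> R) :
  intervals_in U a x p q -> a <= x -> x <= y -> `[x, y] `<=` U ->
  intervals_in U a y (fun i => oapp p x (unlift ord0 i))
                       (fun i => oapp q y (unlift ord0 i)).
Proof.
move=> [pq tpq] ax xy xyU; split.
  move=> i; case: unliftP => [j|] _ /=; last by split.
  have [? ? ? ?] := pq j; split => //; exact: le_trans xy.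
move=> i j _ _; case: unliftP => [i'|] ->; case: unliftP => [j'|] -> //=.
- by move=> /(tpq i' j' I I) ->.
- move=> [z []] /=; rewrite !in_itv /= => /andP[_ zq] /andP[xz _].
  have [_ _ qx _] := pq i'.
  by have := lt_trans xz (lt_le_trans zq qx); rewrite ltxx.
- move=> [z []] /=; rewrite !in_itv /= => /andP[xz _] /andP[_ zq].
  have [_ _ qx _] := pq j'.
  by have := lt_trans xz (lt_le_trans zq qx); rewrite ltxx.
Qed.

Lemma intervals_in_widen (U : set R) a x y k (p q : 'I_k -> R) :
  intervals_in U a x p q -> x <= y -> intervals_in U a y p q.
Proof.
move=> [pq tpq] xy; split => // i; have [? ? ? ?] := pq i.
by split => //; exact: le_trans xy.
Qed.

Lemma intervals_in_length (U : set R) a x k (p q : 'I_k -> R) (d : R) :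
  open U -> intervals_in U a x p q -> (lebesgue_measure U < d%:E)%E ->
  \sum_i (q i - p i) < d.
Proof.
move=> oU [pq tpq]; rewrite -lte_fin; apply: le_lt_trans.
rewrite -sumEFin.
have -> : (\sum_(i < k) (q i - p i)%:E =
    \sum_(i < k) lebesgue_measure (`]p i, q i[%classic : set R))%E.
  apply: eq_bigr => i _; rewrite lebesgue_measure_itv /= lte_fin.
  have [_ pqi _ _] := pq i.
  case: ifPn => [|]; rewrite ?EFinB// -leNgt => qp; congr EFin; lra.
rewrite -(measure_bigsetU_ord lebesgue_measure predT)//.
apply: le_measure; rewrite ?inE//.
- exact: bigsetU_measurable.
- exact: measurable_realfun.open_measurable.
- elim/big_ind: _ => [|A B AU BU|i _]; [by []|by rewrite subUset|].
  move=> z; have [_ _ _ sU] := pq i; rewrite /= in_itv /= => /andP[pz zq].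
  by apply: sU; rewrite /= in_itv /= !ltW.
Qed.

(** The mean value inequality for absolutely continuous functions with the
    derivative bounded only almost everywhere. The exceptional null set E is
    covered by an open set U so small that the increments of f over disjoint
    intervals inside U add up to less than e. Let s be the supremum of the x in
    [a, b] such that f x - f a is at most (c + e) (x - a) plus the increments over
    a family of disjoint intervals of [a, x] inside U. If s is outside E, the
    derivative bound extends the estimate past s; if s is in E, one more interval
    around s inside U does. Hence s = b. *)
Lemma ac_increment_le (f : R -> R) (a b c : R) :
  AC f -> 0 <= c -> 0 <= a -> a <= b -> b <= T ->
  {ae time_measure T, forall t : R, a <= t <= b ->
     exists2 d, d <= c & is_derive t (1 : R) f d} ->
  f b - f a <= c * (b - a).
Proof.
move=> acf c0 a0 ab bT [Z [mZ Z0 PZ]].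
apply/ler_addgt0Pr => e1 e10.
pose e := e1 / (1 + (b - a)).
have e0 : 0 < e by rewrite divr_gt0//; lra.
have [del del0 Hdel] := acf e e0.
pose E := Z `&` `[0, T].
have mE : measurable E by apply: measurableI.
have E0 : lebesgue_measure E = 0%E by exact: Z0.
have [U [oU EU Ud]] := @lebesgue_regularity_outer R E del mE
  (eq_ind_r (fun x => (x < +oo)%E) (ltry 0) E0) del0.
have {}Ud : (lebesgue_measure U < del%:E)%E.
  have mU : measurable U by exact: measurable_realfun.open_measurable.
  rewrite -(setDUK EU) measureU//; last 2 first.
  - exact: measurableD.
  - by rewrite setDE setICA setICr setI0.
  by rewrite [X in (X + _)%E]E0 add0e.
pose S := [set x | [/\ a <= x, x <= b & exists (k : nat) (p q : 'I_k -> R),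
   intervals_in U a x p q /\
   f x - f a <= (c + e) * (x - a) + \sum_i `|f (q i) - f (p i)| ] ].
have Sa : S a.
  split => //; exists 0%N, (fun=> 0), (fun=> 0); split.
    by split; [case|move=> []].
  by rewrite big_ord0 !subrr mulr0 addr0.
have hS : has_sup S by split; [exists a|exists b => x []].
pose s := sup S.
have as_ : a <= s by apply: sup_upper_bound.
have sb : s <= b by apply: sup_le_ub; [exists a|move=> x []].
have [r r0 Hr] : exists2 r, 0 < r & forall x y, s - r < x -> x <= s -> s <= y ->
    y < s + r -> S x -> y <= b -> S y.
  have [sE|sE] := pselect (E s).
    (* s is exceptional: the whole of [x, y] becomes a new interval of the family *)
    have /open_nbhs_nbhs : open_nbhs s U by split => //; exact: EU.
    case=> r /= r0 rU; exists r => // x y sx xs sy ys.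
    move=> [ax xb [k [p [q [pq fx]]]]] yb.
    have xyU : `[x, y] `<=` U.
      move=> z; rewrite /= in_itv /= => /andP[xz zy]; apply: rU.
      by rewrite /ball_ /= ltr_norml; lra.
    split => //; first lra.
    exists k.+1, (fun i => oapp p x (unlift ord0 i)),
      (fun i => oapp q y (unlift ord0 i)); split.
      by apply: intervals_in_cons pq _ _ _ => //; lra.
    rewrite big_ord_recl unlift_none /=.
    under eq_bigr do rewrite liftK /=.
    have : f y - f x <= `|f y - f x| by exact: ler_norm.
    have : 0 <= (c + e) * (y - x) by rewrite mulr_ge0; lra.
by nra.
  have [d dc fd] : exists2 d, d <= c & is_derive s (1 : R) f d.
    apply: contrapT => nd; apply: sE; split; last first.
      by rewrite /= in_itv /=; lra.
    by apply: PZ => /= H; apply: nd; apply: H; lra.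
  have [r r0 Hr] := derive_local_le fd e0.
  exists r => // x y sx xs sy ys [ax xb [k [p [q [pq fx]]]]] yb.
  split => //; first lra.
  exists k, p, q; split; first by apply: intervals_in_widen pq _; lra.
  have := Hr x y sx xs sy ys.
  have : (d + e) * (y - x) <= (c + e) * (y - x) by rewrite ler_wpM2r//; lra.
  by move: fx; nra.
have Sb : S b.
  have [x Sx sx] := sup_adherent r0 hS.
  have xs : x <= s by exact: sup_upper_bound.
  pose y := Order.min b (s + r / 2).
  have yb : y <= b by rewrite ge_min lexx.
  have Sy : S y by apply: (Hr x) => //; rewrite /y ?le_min ?gt_min//; lra.
  have : y <= s by exact: sup_upper_bound.
  move: Sy; rewrite /y minEle; case: ifPn => // _ _; lra.
case: Sb => _ _ [k [p [q [pq fb]]]]; have [pq' tpq] := pq.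
have pqT : forall i, 0 <= p i /\ p i <= q i /\ q i <= T.
  by move=> i; have [? ? ? _] := pq' i; split; [lra|split => //; lra].
have := Hdel k p q pqT tpq (intervals_in_length oU pq Ud).
have -> : e1 = e * (b - a) + e by rewrite /e; field; lra.
by nra.
Qed.

(** Sums, products and Lipschitz functions are all instances of this comparison. *)
Lemma ac_dominated (f g h : R -> R) (C : R) : AC f -> AC g -> 0 <= C ->
  (forall x y, 0 <= x <= T -> 0 <= y <= T ->
     `|h y - h x| <= C * (`|f y - f x| + `|g y - g x|)) -> AC h.
Proof.
move=> acf acg C0 hh e e0.
pose e' := e / (2 * (C + 1)).
have e'0 : 0 < e' by rewrite divr_gt0//; lra.
have [d1 d10 H1] := acf e' e'0; have [d2 d20 H2] := acg e' e'0.
exists (Order.min d1 d2); first by rewrite lt_min d10.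
move=> k a b ab tab; rewrite lt_min => /andP[l1 l2].
have := H1 k a b ab tab l1; have := H2 k a b ab tab l2 => G F.
have : \sum_i `|h (b i) - h (a i)| <=
    C * (\sum_i `|f (b i) - f (a i)| + \sum_i `|g (b i) - g (a i)|).
  rewrite -big_split mulr_sumr; apply: ler_sum => i _ /=.
  by have [? [? ?]] := ab i; apply: hh; lra.
move=> /le_lt_trans; apply.
have -> : e = 2 * (C + 1) * e' by rewrite /e'; field; lra.
have : 0 <= \sum_i `|f (b i) - f (a i)| by apply: sumr_ge0.
have : 0 <= \sum_i `|g (b i) - g (a i)| by apply: sumr_ge0.
nra.
Qed.

Lemma ac_id : AC id.
Proof.
move=> e e0; exists e => // k a b ab _; apply: le_lt_trans.
by apply: ler_sum => i _; have [? [? ?]] := ab i; rewrite ger0_norm//; lra.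
Qed.

Lemma ac_lipschitz (h : R -> R) (C : R) : 0 <= C ->
  (forall x y, 0 <= x <= T -> 0 <= y <= T -> `|h y - h x| <= C * `|y - x|) ->
  AC h.
Proof.
move=> C0 hh; apply: (ac_dominated ac_id ac_id C0) => x y xT yT.
apply: le_trans (hh x y xT yT) _; rewrite ler_wpM2l// lerDl; exact: normr_ge0.
Qed.

(** Walking along [0, T] in steps shorter than the modulus for the tolerance 1, f
    moves by less than 1 at each step. *)
Lemma ac_bounded (f : R -> R) : AC f ->
  exists2 M, 0 <= M & forall x, 0 <= x <= T -> `|f x| <= M.
Proof.
move=> /(_ 1 ltr01)[d d0 Hd].
have step x y : 0 <= x -> x <= y -> y <= T -> y - x < d -> `|f y - f x| < 1.
  move=> x0 xy yT yxd.
  have := Hd 1%N (fun=> x) (fun=> y); rewrite !big_ord1; apply => //.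
  by move=> i j _ _ _; rewrite !ord1.
have bnd k : forall x, 0 <= x <= T -> x <= k%:R * (d / 2) ->
    `|f x| <= `|f 0| + k%:R.
  elim: k => [|k IH] x xT.
    rewrite mul0r addr0 => x0; have -> // : x = 0 by lra.
  rewrite -natr1 => xk.
  have [xd|xd] := leP x (d / 2).
    have := step 0 x; have := ler_normD (f x - f 0) (f 0); rewrite subrK.
    have : 0 <= k%:R :> R by [].
    lra.
  have := step (x - d / 2) x; have := IH (x - d / 2).
  have := ler_normD (f x - f (x - d / 2)) (f (x - d / 2)); rewrite subrK.
  lra.
exists (`|f 0| + (Num.bound (T / (d / 2)))%:R); first by rewrite addr_ge0.
move=> x xT; apply: bnd => //; rewrite -ler_pdivrMr; last lra.
have x0 : 0 <= x / (d / 2) by rewrite divr_ge0//; lra.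
apply: (@le_trans _ _ (T / (d / 2))).
  by rewrite ler_wpM2r ?invr_ge0//; lra.
apply: ltW; apply: archi_boundP; rewrite divr_ge0//; lra.
Qed.

Lemma acD (f g : R -> R) : AC f -> AC g -> AC (fun t => f t + g t).
Proof.
move=> acf acg; apply: (ac_dominated acf acg ler01) => x y _ _.
by rewrite mul1r opprD addrACA ler_normD.
Qed.

Lemma acM (f g : R -> R) : AC f -> AC g -> AC (fun t => f t * g t).
Proof.
move=> acf acg; have [M M0 fM] := ac_bounded acf.
have [P P0 gP] := ac_bounded acg.
apply: (ac_dominated acf acg (addr_ge0 M0 P0)) => x y xT yT.
have -> : f y * g y - f x * g x = f y * (g y - g x) + (f y - f x) * g x by ring.
apply: le_trans (ler_normD _ _) _; rewrite !normrM.
have := fM y yT; have := gP x xT.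
have := normr_ge0 (f y - f x); have := normr_ge0 (g y - g x).
by nra.
Qed.

Lemma acN (f : R -> R) : AC f -> AC (fun t => - f t).
Proof.
move=> acf; apply: (ac_dominated acf acf ler01) => x y _ _.
by rewrite -opprD normrN mul1r lerDl.
Qed.

Lemma ac_sum n (f : 'I_n -> R -> R) : (forall i, AC (f i)) ->
  AC (fun t => \sum_i f i t).
Proof.
elim: n f => [|n IH] f acf.
  apply: (ac_lipschitz (C := 0)) => // x y _ _.
  by rewrite !big_ord0 subrr normr0 mul0r.
under eq_fun do rewrite big_ord_recl.
exact: (acD (acf ord0) (IH (fun i => f (lift ord0 i)) (fun i => acf _))).
Qed.

Lemma ac_expRN (c : R) : 0 <= c -> AC (fun t => expR (- (c * t))).
Proof.
move=> c0; apply: (ac_lipschitz c0).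
have main x y : 0 <= x -> x <= y ->
    `|expR (- (c * y)) - expR (- (c * x))| <= c * `|y - x|.
  move=> x0 xy; rewrite distrC [`|y - x|]ger0_norm ?subr_ge0//.
  rewrite ger0_norm; last first.
    by rewrite subr_ge0 ler_expR lerN2 ler_wpM2l.
  have -> : - (c * y) = - (c * x) + - (c * (y - x)) by ring.
  rewrite expRD -[X in X - _]mulr1 -mulrBr.
  have := expR_ge1Dx (- (c * (y - x))).
  have : expR (- (c * x)) <= 1 by rewrite -expR0 ler_expR oppr_le0 mulr_ge0.
  have := expR_gt0 (- (c * x)).
  have : 0 <= c * (y - x) by rewrite mulr_ge0// subr_ge0.
  set p := expR _; set q := expR _; set z := c * _; nra.
move=> x y xT yT; have [xy|yx] := leP x y; first by apply: main => //; lra.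
by rewrite distrC [`|y - x|]distrC; apply: main; lra.
Qed.

Lemma is_derive_fsum n (y : 'I_n -> R -> R) (t : R) (dy : 'I_n -> R) :
  (forall i, is_derive t (1 : R) (y i) (dy i)) ->
  is_derive t (1 : R) (fun r => \sum_i y i r) (\sum_i dy i).
Proof.
move=> H; have := is_derive_sum H.
by congr is_derive; apply/funext => r; rewrite fct_sumE.
Qed.

(** The energy sum_i y_i^2 has derivative at most c = 2 n M times itself, because
    2 |y_i y_j| <= y_i^2 + y_j^2; so exp(-c t) times the energy is absolutely
    continuous with a nonpositive derivative almost everywhere. *)
Lemma gronwall n (y : 'I_n -> R -> R) (a : R -> 'M[R]_n) (M s : R) :
  (forall i, AC (y i)) -> 0 <= M -> 0 <= s ->
  {ae time_measure T, forall t : R, s <= t <= T ->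
     (forall i j, `|a t i j| <= M) /\
     forall i, is_derive t (1 : R) (y i) (\sum_j a t i j * y j t)} ->
  forall t, s <= t <= T ->
    \sum_i y i t ^+ 2 <= expR (2 * n%:R * M * (t - s)) * \sum_i y i s ^+ 2.
Proof.
move=> acy M0 s0 yae t /andP[st tT].
pose c := 2 * n%:R * M.
have c0 : 0 <= c by rewrite !mulr_ge0.
pose h r := expR (- (c * r)) * \sum_i y i r ^+ 2.
have ach : AC h.
  apply: acM; first exact: ac_expRN.
  by apply: ac_sum => i; apply: acM; exact: acy.
have : h t - h s <= 0 * (t - s).
  apply: ac_increment_le => //.
  case: yae => Z [mZ Z0 ZP]; exists Z; split => // r /= nr; apply: ZP => /= H.
  apply: nr => /andP[sr rt].
  have {H} [|aM dy] := H; first by lra.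
  have de : is_derive r (1 : R) (fun x => expR (- (c * x)))
      (expR (- (c * r)) * (- c)).
    apply: (is_derive1_comp (f := expR) (g := fun x => - (c * x))).
    by apply: is_derive_eq; rewrite /GRing.scale /= mulr1.
  have dq := is_derive_fsum (fun i => is_deriveM (dy i) (dy i)).
  eexists; last exact: is_deriveM de dq.
  rewrite /GRing.scale /=.
  rewrite [X in _ + X]mulrCA -mulrDr.
  rewrite pmulr_rle0 ?expR_gt0// mulrN subr_le0.
  have bound i : y i r * (\sum_j a r i j * y j r) +
      y i r * (\sum_j a r i j * y j r) <=
      M * \sum_j (y i r ^+ 2 + y j r ^+ 2).
    rewrite -mulrDr -big_split /= mulr_sumr mulr_sumr.
    apply: ler_sum => j _.
    have := aM i j; rewrite ler_norml => /andP[? ?].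
    have : 0 <= (y i r + y j r) ^+ 2 by exact: sqr_ge0.
    have : 0 <= (y i r - y j r) ^+ 2 by exact: sqr_ge0.
    by nra.
  apply: le_trans (ler_sum _ (fun i _ => bound i)) _.
  rewrite -mulr_sumr [leRHS](_ : _ = (\sum_i y i r ^+ 2) * c); last by [].
  have -> : \sum_i \sum_j (y i r ^+ 2 + y j r ^+ 2) =
      \sum_i (y i r ^+ 2 *+ n + \sum_j y j r ^+ 2).
    by apply: eq_bigr => i _; rewrite big_split /= sumr_const card_ord.
  rewrite big_split /= sumr_const card_ord sumrMnl.
  move: (\sum_i _) => Q; rewrite -mulrnDl -(mulr_natr (Q + Q)) /c.
  by rewrite (_ : M * _ = Q * (2 * n%:R * M))//; ring.
rewrite mul0r subr_le0 /h => hts.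
have -> : expR (2 * n%:R * M * (t - s)) = expR (c * t) * expR (- (c * s)).
  by rewrite -expRD; congr expR; rewrite /c; ring.
rewrite -mulrA; apply: le_trans (ler_wpM2l (expR_ge0 _) hts).
by rewrite mulrA -expRD subrr expR0 mul1r.
Qed.

End AbsoluteContinuity.

(** * Dependence of the transition matrix on the initial time *)

Section Transition.
Variables (R : realType) (T : R).

(** On a null space the L^oo norm is 0 by convention, which is why the measure of
    the whole space is inspected. *)
Lemma Linfty_bound n p (A : R -> 'M[R]_(n, p)) : Linfty_mx T A ->
  exists2 M, 0 <= M &
    {ae time_measure T, forall t : R, forall i j, `|A t i j| <= M}.
Proof.
move=> LA.
have H (ij : 'I_n * 'I_p) : exists M, 
    {ae time_measure T, forall t : R, `|A t ij.1 ij.2| <= M}.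
  have := LA ij.1 ij.2; rewrite inE => /andP[_]; rewrite inE /=.
  rewrite /finite_norm unlock; case: ifPn => [_|].
    by move=> /ess_supr_bounded.
  rewrite -leNgt => m0 _; exists 0; exists setT; split => //.
  by apply/eqP; rewrite eq_le m0 measure_ge0.
have [M MP] := choice H.
exists (\sum_ij `|M ij|); first exact: sumr_ge0.
have /filter_forall := MP.
apply: filterS => t tM i j; apply: le_trans (tM (i, j)) _.
apply: le_trans (ler_norm _) _.
by rewrite (bigD1 (i, j)) //= lerDl sumr_ge0.
Qed.

(** Only the first argument of the transition matrix is governed by an equation,
    yet the input map integrates over the second one. For s <= s', the columns
    of Phi(., s) and Phi(., s') solve the same equation on [s', T]; at time s'
    they differ by Phi(s', s) - 1, of size O(s' - s) since Phi(., s) starts from 1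
    with a bounded derivative; Gronwall's inequality carries this difference to
    the time T. *)
Lemma transition_lipschitz n (A : R -> 'M[R]_n) (Phi : R -> R -> 'M[R]_n) :
  Linfty_mx T A -> transition_matrix T A Phi ->
  exists2 C, 0 <= C & forall s s', 0 <= s <= T -> 0 <= s' <= T ->
    forall i j, `|Phi T s' i j - Phi T s i j| <= C * `|s' - s|.
Proof.
move=> LA PhiA; have [M M0 AM] := Linfty_bound LA.
have aeF : Filter (almost_everywhere (time_measure T)) by apply: _.
pose c := 2 * n%:R * M.
have c0 : 0 <= c by rewrite !mulr_ge0.
pose Y := 1 + expR (c * T).
have Y0 : 0 <= Y by rewrite addr_ge0// expR_ge0.
have sq_bound n' (y : 'I_n' -> R) (b : R) i : 0 <= b ->
    \sum_i y i ^+ 2 <= b ^+ 2 -> `|y i| <= b.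
  move=> b0 H; rewrite -(ler_pXn2r (n := 2))// ?nnegrE// real_normK ?num_real//.
  apply: le_trans H; rewrite (bigD1 i)//= lerDl sumr_ge0// => k _; exact: sqr_ge0.
have exp_le r : 0 <= r -> r <= T -> expR (c * r) <= expR (c * T).
  by move=> r0 rT; rewrite ler_expR ler_wpM2l.
have deriv s j : 0 <= s <= T -> {ae time_measure T, forall t : R, 
    (forall i k, `|A t i k| <= M) /\ forall i,
    is_derive t (1 : R) (fun r => Phi r s i j) (\sum_k A t i k * Phi t s k j)}.
  move=> sT; have [_ _ H] := PhiA s sT.
  apply: (@filterS2 _ _ aeF _ _ _ _ AM H) => t AtM Ht; split => // i.
  by have := Ht i j; rewrite mxE.
(* Y bounds sqrt (exp (c T)), the growth of a column started at a basis vector *)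
have bound s t i j : 0 <= s -> s <= t -> t <= T -> `|Phi t s i j| <= Y.
  move=> s0 st tT; have sT : 0 <= s <= T by lra.
  have [P1 acP _] := PhiA s sT.
  apply: (sq_bound _ (fun i => Phi t s i j)) => //.
  have := gronwall (fun i => acP i j) M0 s0 (a := A).
  move=> /(_ _ t) H; apply: le_trans (H _ _) _; last 2 first.
  - by rewrite st.
  - rewrite P1 (bigD1 j)//= big1 ?addr0; last first.
      by move=> k /negPf kj; rewrite mxE kj expr0n.
    rewrite mxE eqxx expr1n mulr1; apply: le_trans (exp_le _ _ _) _; try lra.
    rewrite /Y; have := expR_gt0 (c * T); nra.
  - by apply: (@filterS _ _ aeF _ _ _ (deriv s j sT)) => r ? _.
have close s s' i j : 0 <= s -> s <= s' -> s' <= T ->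
    `|Phi s' s i j - (1%:M : 'M[R]_n) i j| <= n%:R * M * Y * (s' - s).
  move=> s0 ss' s'T; have sT : 0 <= s <= T by lra.
  have [P1 acP _] := PhiA s sT.
  have C0 : 0 <= n%:R * M * Y by rewrite !mulr_ge0.
  have dbound t : s <= t -> t <= T -> (forall i k, `|A t i k| <= M) ->
      `|\sum_k A t i k * Phi t s k j| <= n%:R * M * Y.
    move=> st tT AtM; apply: le_trans (ler_norm_sum _ _ _) _.
    apply: (@le_trans _ _ (\sum_(k < n) M * Y)).
      by apply: ler_sum => k _; rewrite normrM ler_pM// bound.
    by rewrite sumr_const card_ord -(mulr_natl (M * Y)) mulrA.
  rewrite -P1 ler_norml; apply/andP; split.
    rewrite lerNl opprB [X in X - _](_ : _ = - - Phi s s i j);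
      last by rewrite opprK.
    rewrite addrC.
    apply: (ac_increment_le (f := fun t => - Phi t s i j) (acN (acP i j))) => //.
    apply: (@filterS _ _ aeF _ _ _ (deriv s j sT)) => t [AtM dt] /andP[st ts'].
    eexists; last exact: is_deriveN (dt i).
    have := dbound t st (le_trans ts' s'T) AtM; rewrite ler_norml; lra.
  apply: (ac_increment_le (f := fun t => Phi t s i j) (acP i j)) => //.
  apply: (@filterS _ _ aeF _ _ _ (deriv s j sT)) => t [AtM dt] /andP[st ts'].
  eexists; last exact: (dt i).
  by have := dbound t st (le_trans ts' s'T) AtM; rewrite ler_norml; lra.
pose D := n%:R * M * Y.
have D0 : 0 <= D by rewrite !mulr_ge0.
have half s s' i j : 0 <= s -> s <= s' -> s' <= T ->
    `|Phi T s i j - Phi T s' i j| <= Y * (n%:R * D) * (s' - s).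
  move=> s0 ss' s'T; have sT : 0 <= s <= T by lra.
  have s'0 : 0 <= s' by lra.
  have s'T' : 0 <= s' <= T by lra.
  have [P1 acP _] := PhiA s sT; have [P1' acP' _] := PhiA s' s'T'.
  have G := @gronwall R T n (fun k r => Phi r s k j + - Phi r s' k j) A M s'
    (fun k => acD (acP k j) (acN (acP' k j))) M0 s'0.
  apply: (sq_bound _ (fun i => Phi T s i j - Phi T s' i j)).
    by rewrite !mulr_ge0//; lra.
  apply: le_trans (G _ T _) _; last 2 first.
  - by rewrite s'T lexx.
  - rewrite P1'.
    apply: (@le_trans _ _ (expR (c * T) * \sum_(k < n) (D * (s' - s)) ^+ 2)).
      apply: ler_pM; rewrite ?expR_ge0 ?sumr_ge0//.
      + by move=> k _; exact: sqr_ge0.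
      + by apply: exp_le; lra.
      + apply: ler_sum => k _; rewrite -real_normK ?num_real//.
        by rewrite lerXn2r ?nnegrE ?mulr_ge0 ?close//; lra.
    rewrite sumr_const card_ord -(mulr_natl (_ ^+ 2)).
    set w := (D * _) ^+ 2.
    have -> : (Y * (n%:R * D) * (s' - s)) ^+ 2 = Y ^+ 2 * (n%:R ^+ 2 * w).
      by rewrite /w; ring.
    have w0 : 0 <= w by exact: sqr_ge0.
    apply: ler_pM; rewrite ?expR_ge0 ?(mulr_ge0 _ w0)//.
      by rewrite /Y; have := expR_gt0 (c * T); nra.
    rewrite ler_wpM2r// -natrX ler_nat expnS expn1.
    by case: (n) => // k; rewrite leq_pmulr.
  - apply: (@filterS2 _ _ aeF _ _ _ _ (deriv s j sT) (deriv s' j s'T')).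
    move=> t [AtM d1] [_ d2] _.
    split => // k.
    have := is_deriveB (d1 k) (d2 k); congr is_derive.
    by rewrite -sumrB; apply: eq_bigr => l _; rewrite mulrBr.
exists (Y * (n%:R * D)); first by rewrite !mulr_ge0.
move=> s s' sT s'T i j; have [ss'|/ltW s's] := leP s s'.
  by rewrite distrC [`|s' - s|]ger0_norm ?subr_ge0//; apply: half; lra.
rewrite [`|s' - s|]distrC [`|s - s'|]ger0_norm ?subr_ge0//.
by apply: half; lra.
Qed.

End Transition.

(** * Semi-inner product spaces: minimization, Riesz, nearest points *)

Section SemiInnerProduct.
Variables (R : realType) (H : lmodType R) (d : H -> H -> R).

(** Square-integrable functions are not identified when equal almost everywhere,
    so the pairing on them is only positive semidefinite and d u u = 0 does not
    force u = 0. *)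
Record semi_inner_product : Prop := SemiInnerProduct {
  sip_linear : forall a u v w, d (a *: u + v) w = a * d u w + d v w;
  sip_sym : forall u v, d u v = d v u;
  sip_ge0 : forall u, 0 <= d u u }.

Definition sip_complete := forall x : nat -> H,
  (forall e, 0 < e -> exists K, forall i j, (K <= i)%N -> (K <= j)%N ->
     d (x i - x j) (x i - x j) < e) ->
  exists l, forall e, 0 < e -> exists K, forall i, (K <= i)%N ->
     d (x i - l) (x i - l) < e.

Definition sip_closed (G : set H) :=
  forall u, (forall e, 0 < e -> exists2 g, G g & d (u - g) (u - g) < e) -> G u.

(** Convexity of G, spelled out with a real coefficient. *)
Definition segment_closed (G : set H) := forall a b t,
  G a -> G b -> 0 <= t -> t <= 1 ->
  G (t *: a + (1 - t) *: b).

Definition bounded_form (l : H -> R) (M : R) :=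
  (forall a u v, l (a *: u + v) = a * l u + l v) /\
  (forall v, l v ^+ 2 <= M * d v v).

Hypothesis dP : semi_inner_product.

Lemma sipDl u v w : d (u + v) w = d u w + d v w.
Proof. by rewrite -[u]scale1r (sip_linear dP) mul1r scale1r. Qed.
Lemma sip0l w : d 0 w = 0.
Proof. by have := sipDl 0 0 w; rewrite addr0; lra. Qed.
Lemma sipZl a u w : d (a *: u) w = a * d u w.
Proof. by rewrite -[_ *: u]addr0 (sip_linear dP) sip0l addr0. Qed.
Lemma sipNl u w : d (- u) w = - d u w.
Proof. by rewrite -scaleN1r sipZl mulN1r. Qed.
Lemma sipDr u v w : d u (v + w) = d u v + d u w.
Proof. by rewrite !(sip_sym dP u) sipDl. Qed.
Lemma sipZr a u w : d u (a *: w) = a * d u w.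
Proof. by rewrite !(sip_sym dP u) sipZl. Qed.
Lemma sipNr u w : d u (- w) = - d u w.
Proof. by rewrite !(sip_sym dP u) sipNl. Qed.
Lemma sip_suml (I : finType) (y : I -> H) w : d (\sum_i y i) w = \sum_i d (y i) w.
Proof.
by apply: (big_morph (d ^~ w) (fun u v => sipDl u v w)); exact: sip0l.
Qed.

Definition sipE := (sipDl, sipDr, sipNl, sipNr, sipZl, sipZr).

Lemma sip_cauchy_schwarz u v : d u v ^+ 2 <= d u u * d v v.
Proof.
have [u0|u0] := eqVneq (d u u) 0.
  have H0 t : 0 <= 2 * t * d u v + d v v.
    have := sip_ge0 dP (t *: u + v); rewrite !sipE u0 (sip_sym dP v u); lra.
  have -> : d u v = 0; last by rewrite expr0n u0 mul0r.
  apply/eqP; apply: contrapT => /negP uv0.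
  have := H0 (- (d v v + 1) / (2 * d u v)).
  have -> : 2 * (- (d v v + 1) / (2 * d u v)) * d u v = - (d v v + 1) by field.
  lra.
have ugt0 : 0 < d u u by rewrite lt_neqAle eq_sym u0 (sip_ge0 dP).
have := sip_ge0 dP (d u u *: v - d u v *: u).
rewrite !sipE (sip_sym dP v u) => K.
rewrite -subr_ge0 -(pmulr_rge0 _ ugt0); move: K.
by congr (0 <= _); ring.
Qed.

Lemma sip_null u v : d u u = 0 -> d u v = 0.
Proof.
move=> u0; have := sip_cauchy_schwarz u v; rewrite u0 mul0r => H0.
by apply/eqP; rewrite -sqrf_eq0 eq_le H0 sqr_ge0.
Qed.

Section BoundedForm.
Variables (l : H -> R) (M : R).
Hypothesis lM : bounded_form l M.
Let lin : forall a u v, l (a *: u + v) = a * l u + l v. Proof. by case: lM. Qed.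

Lemma formD u v : l (u + v) = l u + l v.
Proof. by rewrite -[u]scale1r lin mul1r scale1r. Qed.
Lemma form0 : l 0 = 0.
Proof. by have := formD 0 0; rewrite addr0; lra. Qed.
Lemma formZ a u : l (a *: u) = a * l u.
Proof. by rewrite -[_ *: u]addr0 lin form0 addr0. Qed.
Lemma formN u : l (- u) = - l u.
Proof. by rewrite -scaleN1r formZ mulN1r. Qed.
Let formE := (formD, formN, formZ).

Let energy y := d y y - 2 * l y.

(** The energy d y y - 2 l y is bounded below and satisfies the parallelogram
    identity d (a - b) (a - b) = 2 E a + 2 E b - 4 E ((a + b) / 2), so a minimizing
    sequence in a convex set is Cauchy; its limit is a minimizer. The nearest
    point (l = d u) and the Riesz representation (G the whole space) are both
    instances. *)
Lemma energy_minimizer (G : set H) g0 : sip_complete -> sip_closed G ->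
  segment_closed G -> 0 <= M -> G g0 ->
  exists2 p, G p & forall g, G g -> energy p <= energy g.
Proof.
move=> cplt Gcl Gcv M0 Gg0.
have lb y : - M <= energy y.
  rewrite /energy; have := sip_ge0 dP y; have [_ /(_ y)] := lM.
  set Q := d y y; set L := l y => LQ Q0.
  rewrite leNgt; apply/negP => h.
  have : 0 < 2 * L - (M + Q) by lra.
  have : 0 <= (M - Q) ^+ 2 by exact: sqr_ge0.
  by nra.
pose E := [set energy g | g in G].
have hE : has_inf E.
  by split; [exists (energy g0), g0|exists (- M) => _ [g _ <-]; exact: lb].
have /choice[x xP] : forall k : nat, exists g,
    G g /\ energy g < inf E + k.+1%:R^-1.
  move=> k; have k0 : 0 < k.+1%:R^-1 :> R by rewrite invr_gt0.
  by have [_ [g Gg <-] ?] := inf_adherent k0 hE; exists g.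
have infE g : G g -> inf E <= energy g.
  by move=> Gg; apply: ge_inf; [case: hE|exists g].
have small e : 0 < e -> exists K : nat, forall i,
    (K <= i)%N -> i.+1%:R^-1 < e :> R.
  move=> e0; exists (Num.bound e^-1) => i Ki.
  rewrite invf_plt ?posrE//.
  apply: lt_le_trans (archi_boundP _) _; first by rewrite invr_ge0 ltW.
  by rewrite ler_nat; exact: leqW.
have [|p pP] := cplt x.
  move=> e e0; have [|K KP] := small (e / 4); first by lra.
  exists K => i j Ki Kj.
  have [Gi xi] := xP i; have [Gj xj] := xP j.
  have := KP i Ki; have := KP j Kj.
  have Gm : G (2^-1 *: x i + (1 - 2^-1) *: x j) by apply: Gcv => //; lra.
  have := infE _ Gm; have -> : 1 - 2^-1 = 2^-1 :> R by lra.
  move: xi xj; rewrite /energy !sipE !formE (sip_sym dP (x j) (x i)).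
    move: (i.+1%:R^-1) (j.+1%:R^-1) => ti tj.
  move: (d _ _) (d (x i) _) (d _ _) (l _) (l _) (inf E) => *; lra.
have Gp : G p.
  apply: Gcl => e e0; have [K KP] := pP e e0.
  exists (x K); first by case: (xP K).
  by rewrite -opprB sipNl sipNr opprK; exact: KP.
exists p => // g Gg; apply: le_trans (infE g Gg).
apply/ler_addgt0Pr => e e0.
pose N := 2 * (d p p + M).
have N0 : 0 <= N by rewrite mulr_ge0 ?addr_ge0// (sip_ge0 dP).
(* with N such that (d p v - l v)^2 <= N d v v, a step v of squared length below
   del changes the linear part of the energy by less than e / 2 *)
pose del := e ^+ 2 / (16 * (N + 1)).
have del0 : 0 < del by rewrite divr_gt0 ?exprn_gt0//; lra.
have [K1 K1P] := pP _ del0; have [|K2 K2P] := small (e / 2); first lra.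
pose k := maxn K1 K2.
have := K1P k (leq_maxl _ _); have := K2P k (leq_maxr _ _).
have [_] := xP k.
have := sip_cauchy_schwarz p (x k - p); have [_ /(_ (x k - p))] := lM.
have -> : energy (x k) = energy p + d (x k - p) (x k - p) +
    2 * (d p (x k - p) - l (x k - p)).
  by rewrite /energy !sipE !formE (sip_sym dP p (x k)); ring.
have := sip_ge0 dP (x k - p).
set q := d (x k - p) _; set a := d p (x k - p); set b := l _ => q0 bq aq hk k2 qd.
have : (a - b) ^+ 2 < (e / 4) ^+ 2.
  have -> : (e / 4) ^+ 2 = del * (N + 1) by rewrite /del; field; lra.
  have : 0 <= (a + b) ^+ 2 by exact: sqr_ge0.
  have -> : del * (N + 1) = q * N + q + (del - q) * (N + 1) by ring.
  have : 0 < (del - q) * (N + 1) by rewrite mulr_gt0//; lra.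
  by rewrite /N; nra.
have e40 : 0 < e / 4 by lra.
move=> h; have ab : - (e / 4) < a - b.
  by rewrite ltNge; apply/negP => ab; move: h; nra.
by move: hk k2; move: (k.+1%:R^-1) (inf E) => *; lra.
Qed.

(** Moving from the minimizer p towards z by a small t changes the energy by
    2 t (d p (z - p) - l (z - p)) + O(t^2). *)
Lemma energy_variational (G : set H) p z : segment_closed G -> G p ->
  (forall g, G g -> energy p <= energy g) -> G z -> l (z - p) <= d p (z - p).
Proof.
move=> Gcv Gp pmin Gz; rewrite -subr_ge0.
pose g := d p (z - p) - l (z - p); pose q := d (z - p) (z - p).
have q0 : 0 <= q by exact: (sip_ge0 dP).
rewrite -/g leNgt; apply/negP => g0.
have step t : 0 <= t -> t <= 1 -> 0 <= 2 * t * g + t ^+ 2 * q.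
  move=> t0 t1; have := pmin _ (Gcv z p t Gz Gp t0 t1).
  rewrite /energy /g /q !sipE !formE (sip_sym dP p z) -subr_ge0.
  by congr (_ <= _); ring.
(* a step in (0, 1] at which the quadratic term cannot compensate g < 0 *)
pose t := - g / (q + 1 - g).
have den : 0 < q + 1 - g by lra.
have t0 : 0 < t by rewrite divr_gt0//; lra.
have tE : t * (q + 1 - g) = - g by rewrite /t divfK// gt_eqF.
have t1 : t <= 1 by rewrite /t ler_pdivrMr//; lra.
have := step t (ltW t0) t1.
have -> : 2 * t * g + t ^+ 2 * q = t * (2 * g + t * (q + 1 - g) - t + t * g).
  by ring.
by rewrite tE pmulr_rge0//; nra.
Qed.

End BoundedForm.

Lemma sip_bounded_form u : bounded_form (d u) (d u u).
Proof.
split; last by move=> v; exact: sip_cauchy_schwarz.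
by move=> a v w; rewrite sipDr sipZr.
Qed.

Hypothesis cplt : sip_complete.

Lemma sip_riesz (l : H -> R) (M : R) : 0 <= M -> bounded_form l M ->
  exists w, forall v, d w v = l v.
Proof.
move=> M0 lM.
have Tcv : segment_closed setT by [].
have [|p _ pmin] := energy_minimizer lM (G := setT) (g0 := 0) cplt _ Tcv M0 I.
  by [].
exists p => v; apply/eqP; rewrite eq_le; apply/andP; split.
  have := energy_variational lM (z := p - v) Tcv I pmin I.
  by rewrite addrC addKr (formN lM) sipNr; lra.
have := energy_variational lM (z := p + v) Tcv I pmin I.
by rewrite addrC addKr.
Qed.

Lemma sip_nearest (G : set H) u : sip_closed G -> segment_closed G -> G !=set0 ->
  exists2 p, G p & forall g, G g -> d (u - p) (u - p) <= d (u - g) (u - g).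
Proof.
move=> Gcl Gcv [g0 Gg0].
have [p Gp pmin] := energy_minimizer (sip_bounded_form u) cplt Gcl Gcv
  (sip_ge0 dP u) Gg0.
exists p => // g /pmin; rewrite !sipE (sip_sym dP p u) (sip_sym dP g u); lra.
Qed.

Lemma nearest_variational (G : set H) u p z : segment_closed G -> G p ->
  (forall g, G g -> d (u - p) (u - p) <= d (u - g) (u - g)) -> G z ->
  d (u - p) (z - p) <= 0.
Proof.
move=> Gcv Gp pmin Gz.
have := energy_variational (sip_bounded_form u) Gcv Gp _ Gz.
rewrite [d (u - p) _]sipDl sipNl subr_le0; apply => g /pmin.
rewrite !sipE (sip_sym dP p u) (sip_sym dP g u); lra.
Qed.

End SemiInnerProduct.

(** * Weak convergence of averaged projections *)

Section Ultra.
Variable R : realType.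

(** A set of indices on which f stays away from l would be contained in an
    ultrafilter finer than F. *)
Lemma cvg_along_ultrafilters (F : set_system nat) (f : nat -> R) (l : R) :
  ProperFilter F ->
  (forall U, UltraFilter U -> F `<=` U -> f @ U --> l) -> f @ F --> l.
Proof.
move=> PF H A lA; apply: contrapT => FA.
have PG : ProperFilter (within (~` (f @^-1` A)) F).
  have wF : Filter (within (~` (f @^-1` A)) F) by apply: within_filter.
  split=> // F0; apply: FA; rewrite /within /= in F0.
  by apply: filterS F0 => k /= nA; exact: contrapT.
have [U [UU GU]] := ultraFilterLemma PG.
have FU : F `<=` U by move=> B FB; apply: GU; apply: filterS FB.
have UA : U (f @^-1` A) by exact: H.
have UnA : U (~` (f @^-1` A)).
  by apply: GU; rewrite /within /=; exact: filterE.
have PU : ProperFilter U by apply: ultra_proper.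
have UI : U ((f @^-1` A) `&` ~` (f @^-1` A)) by exact: filterI.
by have [k []] := filter_ex UI.
Qed.

Lemma fmap_ultra (T S : Type) (f : T -> S) (U : set_system T) :
  UltraFilter U -> UltraFilter (f @ U).
Proof.
move=> UU; split; first exact: fmap_proper_filter.
move=> G PG UG; apply/seteqP; split=> [A GA|]; last exact: UG.
have [//|UA] := in_ultra_setVsetC (f @^-1` A) UU.
have GI : G (A `&` ~` A) by apply: filterI => //; exact: UG.
by have [k []] := filter_ex GI.
Qed.

Lemma ultra_bounded_cvg (U : set_system nat) (f : nat -> R) (M : R) :
  UltraFilter U -> (forall k, `|f k| <= M) -> exists l : R, f @ U --> l.
Proof.
move=> UU fM.
have UM : (f @ U) [set` `[- M, M]].
  by apply: nearW => k; rewrite /= in_itv /= -ler_norml.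
have := @segment_compact R (- M) M; rewrite compact_ultra.
by move=> /(_ (f @ U) (fmap_ultra f UU) UM) [l [_ fl]]; exists l.
Qed.
End Ultra.

Section AveragedProjections.
Variables (R : realType) (H : lmodType R) (d : H -> H -> R).
Hypothesis (dP : semi_inner_product d) (cplt : sip_complete d).
Variables (I : finType) (D : I -> set H) (P : I -> H -> H) (w : I -> R).
Hypothesis P_in : forall i u, D i (P i u).
Hypothesis P_var : forall i u z, D i z -> d (u - P i u) (z - P i u) <= 0.
Hypothesis D_null : forall i p u, D i p -> d (u - p) (u - p) = 0 -> D i u.
Hypothesis w_gt0 : forall i, 0 < w i.
Hypothesis w_sum : \sum_i w i = 1.
Variable x : nat -> H.
Hypothesis xS : forall k, x k.+1 = \sum_i w i *: P i (x k).

(** The defect is the variance sum_i w_i |y_i - s|^2 of the y_i around their mean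
    s. *)
Lemma sq_convex (y : I -> H) :
  d (\sum_i w i *: y i) (\sum_i w i *: y i) <= \sum_i w i * d (y i) (y i).
Proof.
set s := \sum_i w i *: y i.
have : 0 <= \sum_i w i * d (y i - s) (y i - s).
  by apply: sumr_ge0 => i _; rewrite mulr_ge0 ?(ltW (w_gt0 _))// (sip_ge0 dP).
have E i : w i * d (y i - s) (y i - s) =
    w i * d (y i) (y i) + (d s s * w i - 2 * d (w i *: y i) s).
  by rewrite !(sipE dP) (sip_sym dP s); ring.
under eq_bigr do rewrite E.
rewrite big_split sumrB -!mulr_sumr w_sum -(sip_suml dP) -/s /=; lra.
Qed.

(** Each projection contracts the squared distance to a common point z by at least
    the squared displacement; averaging keeps the gain. *)
Lemma fejer k z : (forall i, D i z) ->
  d (x k.+1 - z) (x k.+1 - z) <= d (x k - z) (x k - z) -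
     \sum_i w i * d (x k - P i (x k)) (x k - P i (x k)).
Proof.
move=> Dz.
have -> : x k.+1 - z = \sum_i w i *: (P i (x k) - z).
  under [RHS]eq_bigr do rewrite scalerBr.
  by rewrite sumrB -scaler_suml w_sum scale1r xS.
apply: le_trans (sq_convex _) _.
have -> : d (x k - z) (x k - z) = \sum_i w i * d (x k - z) (x k - z).
  by rewrite -mulr_suml w_sum mul1r.
rewrite -sumrB; apply: ler_sum => i _.
rewrite -mulrBr ler_wpM2l ?(ltW (w_gt0 _))//.
have := P_var (x k) (Dz i); move: (P i (x k)) => p.
rewrite !(sipE dP) (sip_sym dP p z) (sip_sym dP p (x k)).
by rewrite (sip_sym dP z (x k)); lra.
Qed.

Lemma fejer_cvg z : (forall i, D i z) ->
  exists l : R, (fun k => d (x k - z) (x k - z)) @ \oo --> l.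
Proof.
move=> Dz; eexists; apply: nonincreasing_cvgn.
  apply/nonincreasing_seqP => k; apply: le_trans (fejer k Dz) _.
  rewrite lerBlDr lerDl; apply: sumr_ge0 => i _.
  by rewrite mulr_ge0 ?(ltW (w_gt0 _))// (sip_ge0 dP).
by exists 0 => _ [k _ <-]; exact: (sip_ge0 dP).
Qed.

Variable z0 : H.
Hypothesis Dz0 : forall i, D i z0.

(** The squared distances to z0 converge, so their successive decreases, which
    dominate the displacements, tend to 0. *)
Lemma residual_cvg0 i :
  (fun k => d (x k - P i (x k)) (x k - P i (x k))) @ \oo --> (0 : R).
Proof.
have [l xl] := fejer_cvg Dz0.
pose a k := d (x k - z0) (x k - z0).
have da : (fun k => (w i)^-1 * (a k - a k.+1)) @ \oo --> (0 : R).
  rewrite -[X in _ --> X](mulr0 (w i)^-1) -[X in _ * X](subrr l).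
  apply: cvgMl_tmp; apply: cvgB => //.
  by have := xl; rewrite -(cvg_shiftS a).
apply: (squeeze_cvgr _ (cvg_cst (0 : R)) da).
apply: nearW => k; rewrite (sip_ge0 dP) /=.
rewrite mulrC ler_pdivlMr//.
have := fejer k Dz0; rewrite (bigD1 i)//= -/(a k) -/(a k.+1).
set S := \sum_(_ | _) _; have : 0 <= S.
  by apply: sumr_ge0 => j _; rewrite mulr_ge0 ?(ltW (w_gt0 _))// (sip_ge0 dP).
by lra.
Qed.

Lemma iterates_bounded : exists2 M, 0 <= M & forall k, d (x k) (x k) <= M.
Proof.
exists (2 * d (x 0%N - z0) (x 0%N - z0) + 2 * d z0 z0).
  by rewrite addr_ge0 ?mulr_ge0// (sip_ge0 dP).
move=> k.
have : d (x k - z0) (x k - z0) <= d (x 0%N - z0) (x 0%N - z0).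
  elim: k => // k IH; apply: le_trans IH; apply: le_trans (fejer k Dz0) _.
  rewrite lerBlDr lerDl; apply: sumr_ge0 => i _.
  by rewrite mulr_ge0 ?(ltW (w_gt0 _))// (sip_ge0 dP).
(* |x|^2 <= 2 |x - z0|^2 + 2 |z0|^2 is |x - 2 z0|^2 >= 0 *)
have := sip_ge0 dP (x k - 2 *: z0).
move: (d (x 0%N - z0) _) => e.
by rewrite !(sipE dP) (sip_sym dP z0); lra.
Qed.

(** Along an ultrafilter every bounded scalar sequence converges, so the pairings
    with x k converge to a bounded linear form, represented by a vector. This
    replaces the extraction of weakly convergent subsequences. *)
Lemma ultra_weak_limit (U : set_system nat) : UltraFilter U ->
  exists y, forall v, (fun k => d (x k) v) @ U --> d y v.
Proof.
move=> UU; have [M M0 xM] := iterates_bounded.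
have lim v : exists l : R, (fun k => d (x k) v) @ U --> l.
  apply: (@ultra_bounded_cvg _ _ _ (1 + M * d v v)) => k.
  have := sip_cauchy_schwarz dP (x k) v.
  have : d (x k) (x k) * d v v <= M * d v v by rewrite ler_wpM2r// (sip_ge0 dP).
  rewrite -real_normK ?num_real//; have := normr_ge0 (d (x k) v).
  by move: `|_| => r; nra.
have [l lP] := choice lim.
have bl : bounded_form d l M.
  split.
    move=> a u v; apply: (cvg_unique _ (lP _)) => //.
    have -> : (fun k => d (x k) (a *: u + v)) =
        (fun k => a * d (x k) u + d (x k) v).
      by apply/funext => k; rewrite (sipDr dP) (sipZr dP).
    by apply: cvgD => //; apply: cvgMl_tmp.
  move=> v; have lv2 : (fun k => d (x k) v * d (x k) v) @ U --> l v ^+ 2.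
    by rewrite expr2; exact: cvgM.
  apply: (cvgr_to_le lv2); apply: nearW => k; rewrite -expr2.
  apply: le_trans (sip_cauchy_schwarz dP _ _) _.
  by rewrite ler_wpM2r// (sip_ge0 dP).
have [y yP] := sip_riesz dP cplt M0 bl.
by exists y => v; rewrite yP.
Qed.

(** With e = y - P_i y, passing to the limit in <e, P_i (x k) - P_i y> <= 0 gives
    <e, e> <= 0, since P_i (x k) and x k have the same weak limit y: this is the
    demiclosedness of the projection at its fixed points. *)
Lemma weak_cluster_in (U : set_system nat) y : UltraFilter U -> \oo `<=` U ->
  (forall v, (fun k => d (x k) v) @ U --> d y v) -> forall i, D i y.
Proof.
move=> UU oU yU i; pose e := y - P i y.
have cs : (fun k => d e (x k - P i (x k))) @ U --> (0 : R).
  apply: (cvg_trans (cvg_app _ oU)); apply/cvgrPdist_lt => r r0.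
  have ee0 := sip_ge0 dP e.
  have del0 : 0 < r ^+ 2 / (d e e + 1) by rewrite divr_gt0 ?exprn_gt0//; lra.
  have /cvgrPdist_lt /(_ _ del0) := residual_cvg0 i.
  apply: filterS => k; rewrite !sub0r !normrN ger0_norm ?(sip_ge0 dP)//.
  rewrite ltr_pdivlMr; last lra.
  have := sip_cauchy_schwarz dP e (x k - P i (x k)).
  have := sip_ge0 dP (x k - P i (x k)).
  set q := d (x k - _) _ => q0 cs qr.
  rewrite -(ltr_pXn2r (n := 2)) ?nnegrE ?(ltW r0)// real_normK ?num_real//.
  by nra.
have ce : (fun k => d e (P i (x k) - P i y)) @ U --> d e e.
  have -> : (fun k => d e (P i (x k) - P i y)) =
    (fun k => d (x k) e - d (P i y) e - d e (x k - P i (x k))).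
    apply/funext => k.
    rewrite (sip_sym dP (x k) e) (sip_sym dP (P i y)).
    by rewrite !(sipDr dP) !(sipNr dP); ring.
  have -> : d e e = d y e - d (P i y) e - 0.
    by rewrite subr0 -[in RHS](sipNl dP) -(sipDl dP).
  by apply: cvgB => //; apply: cvgB => //; exact: cvg_cst.
have ee : d e e <= 0.
  by apply: (cvgr_to_le ce); apply: nearW => k; exact: P_var (P_in i (x k)).
by apply: (D_null (P_in i y)); apply/eqP; rewrite eq_le ee (sip_ge0 dP).
Qed.

(** Opial's argument: for two weak cluster points y and y' in the intersection,
    |x k - y|^2 and |x k - y'|^2 both converge, hence so does the pairing of x k
    with y - y'; its limits <y, y - y'> and <y', y - y'> along two ultrafilters
    agree, so y - y' is a null vector. *)
Theorem averaged_projections_weak_cvg :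
  exists2 y, (forall i, D i y) & forall v, (fun k => d (x k) v) @ \oo --> d y v.
Proof.
have [U0 [UU0 oU0]] := ultraFilterLemma (_ : ProperFilter \oo).
have [y yU0] := ultra_weak_limit UU0.
have Dy := weak_cluster_in UU0 oU0 yU0.
exists y => // v; apply: cvg_along_ultrafilters => U UU oU.
have [y' yU] := ultra_weak_limit UU.
have Dy' := weak_cluster_in UU oU yU.
suff -> : d y v = d y' v by exact: yU.
have [l xl] := fejer_cvg Dy; have [l' xl'] := fejer_cvg Dy'.
have key : (fun k => d (x k) (y - y')) @ \oo -->
    2^-1 * (l' - l + (d y y - d y' y')).
  have -> : (fun k => d (x k) (y - y')) = (fun k => 2^-1 *
     (d (x k - y') (x k - y') - d (x k - y) (x k - y) + (d y y - d y' y'))).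
    apply/funext => k.
    rewrite !(sipE dP) (sip_sym dP y (x k)) (sip_sym dP y' (x k)).
    by field.
  by apply: cvgMl_tmp; apply: cvgD; [exact: cvgB|exact: cvg_cst].
have c0 := cvg_unique _ (cvg_trans (cvg_app _ oU0) key) (yU0 (y - y')).
have c1 := cvg_unique _ (cvg_trans (cvg_app _ oU) key) (yU (y - y')).
have n0 : d (y - y') (y - y') = 0.
  by rewrite (sipDl dP) (sipNl dP) -c0 // -c1 // subrr.
by have := sip_null dP v n0; rewrite (sipDl dP) (sipNl dP); lra.
Qed.
End AveragedProjections.

(** * Completeness of L^2 *)

Section LfunTwo.
Context (dd : measure_display) (X : measurableType dd) (R : realType).
Variable mu : {measure set X -> \bar R}.

Lemma Lfun2_mem (f : X -> R) : measurable_fun setT f ->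
  (\int[mu]_x (f x ^+ 2)%:E < +oo)%E -> f \in Lfun mu 2%:E.
Proof.
move=> mf fi; rewrite inE; apply/andP; split; rewrite inE//=.
rewrite /finite_norm unlock /= poweR_lty//; apply: le_lt_trans fi.
rewrite le_eqVlt; apply/orP; left; apply/eqP; apply: eq_integral => x _ /=.
by rewrite powR_mulrn// real_normK ?num_real.
Qed.

Notation L2s := (LfunType mu (lee1n 2)).
Definition sq_integral (f : L2s) : R := \int[mu]_x (f x ^+ 2).
Lemma sq_integralE f : (sq_integral f)%:E = (\int[mu]_x (f x ^+ 2)%:E)%E.
Proof.
have /integrableP[mf fi] := Lfun2_integrable_sqr (LfunP f).
rewrite /sq_integral /Rintegral fineK// ge0_fin_numE//; last first.
  by apply: integral_ge0 => x _; rewrite lee_fin sqr_ge0.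
apply: le_lt_trans fi; rewrite le_eqVlt; apply/orP; left; apply/eqP.
by apply: eq_integral => x _ /=; rewrite ger0_norm ?sqr_ge0.
Qed.

Lemma measurable_L2s (f : L2s) : measurable_fun setT f.
Proof. by have := LfunP f; rewrite inE => /andP[+ _]; rewrite inE. Qed.

(** The series S of the 4^j (g_{j+1} - g_j)^2 has a finite integral, so it is finite
    almost everywhere; where it is, |g_{j+1} - g_j| <= 2^-j sqrt S and g_j converges
    geometrically. *)
Lemma rapid_cauchy_cvg (g : nat -> L2s) :
  (forall j, sq_integral (g j.+1 - g j) < (4 ^+ j)^-1 / (2 ^ j.+1)%:R) ->
  exists h : X -> R, measurable_fun setT h /\
   {ae mu, forall t, (fun j => g j t) @ \oo --> h t}.
Proof.
move=> gP.
pose a j t := (4 ^+ j * (g j.+1 t - g j t) ^+ 2)%:E.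
have a0 j t : (0 <= a j t)%E by rewrite lee_fin mulr_ge0 ?sqr_ge0// exprn_ge0.
have ma j : measurable_fun setT (a j).
  apply/measurable_EFinP; apply: measurable_funM => //.
  apply: measurable_funX; apply: measurable_funB; exact: measurable_L2s.
pose S t := (\sum_(0 <= j <oo) a j t)%E.
have mS : measurable_fun setT S.
  apply: ge0_emeasurable_sum => //.
have S0 t : (0 <= S t)%E by apply: nneseries_ge0 => *.
have Sfin : (\int[mu]_t S t < +oo)%E.
  rewrite integral_nneseries//.
  apply: (@le_lt_trans _ _
    (\sum_(0 <= j <oo) ((1 / (2 ^ j.+1)%:R : R)%:E))%E); last first.
    by apply: le_lt_trans (epsilon_trick0 _ ler01) _; rewrite ltry.
  apply: lee_nneseries => [j _ _|j _].
    by apply: integral_ge0 => *.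
  rewrite /a; under eq_integral do rewrite EFinM.
  rewrite ge0_integralZl_EFin ?exprn_ge0//; last 2 first.
  - by move=> x _; rewrite lee_fin sqr_ge0.
  - apply/measurable_EFinP; apply: measurable_funX; apply: measurable_funB;
      exact: measurable_L2s.
  rewrite -(sq_integralE (g j.+1 - g j)) -EFinM lee_fin.
  rewrite mulrC -ler_pdivlMr ?exprn_gt0//.
  by apply: le_trans (ltW (gP j)) _; rewrite mul1r mulrC.
have Sae : {ae mu, forall t, S t \is a fin_num}.
  have iS : mu.-integrable setT S.
    apply/integrableP; split => //.
    by under eq_integral do rewrite gee0_abs//.
  by have := integrable_ae measurableT iS; apply: filterS => t; apply.
pose E := [set t | (S t < +oo)%E].
have mE : measurable E.
  rewrite -[E]setTI; apply: emeasurable_fun_infty_o => //.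
(* cutting off where S is infinite makes the sequence converge everywhere, so the
   limit is measurable *)
pose g' j t := g j t * \1_E t.
have cg' t : cvgn (fun j => g' j t).
  have [tE|tE] := boolP (t \in E); last first.
    under eq_fun do rewrite /g' indicE (negPf tE) mulr0.
    exact: is_cvg_cst.
  under eq_fun do rewrite /g' indicE tE mulr1.
  have [s s0 sS] : exists2 s : R, 0 <= s & S t = s%:E.
    exists (fine (S t)); first by rewrite fine_ge0.
    by rewrite fineK// ge0_fin_numE//; rewrite inE in tE.
  (* 1 + s stands for an upper bound of the square root of s *)
  have dS j : `|g j.+1 t - g j t| <= geometric (1 + s) 2^-1 j.
    have : (a j t <= s%:E)%E.
      rewrite -sS; apply: le_trans (nneseries_lim_ge j.+1 _) => //.
      by rewrite big_nat_recr//= leeDr// sume_ge0.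
    rewrite lee_fin => asq; rewrite /geometric /= exprVn ler_pdivlMr ?exprn_gt0//.
    rewrite -(ler_pXn2r (n := 2)) ?nnegrE ?addr_ge0 ?mulr_ge0 ?exprn_ge0//.
    rewrite exprMn real_normK ?num_real// mulrC -exprM mulnC exprM -natrX.
    by apply: le_trans asq _; nra.
  rewrite (_ : (fun j => g j t) =
    (fun j => g 0%N t + series (telescope (fun j => g j t)) j)); last first.
    by apply/funext => j; rewrite -eq_sum_telescope.
  apply: is_cvgD; first exact: is_cvg_cst.
  apply: normed_cvg; apply: (series_le_cvg (v_ := geometric (1 + s) 2^-1)) => //.
  - by move=> j; rewrite /= normr_ge0.
  - by move=> j; rewrite /geometric /= mulr_ge0 ?exprn_ge0//; lra.
  - by apply: is_cvg_geometric_series; rewrite ger0_norm//; lra.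
exists (fun t => limn (fun j => g' j t)); split.
  apply: (@measurable_fun_cvg _ _ _ _ g') => //.
  by move=> j; apply: measurable_funM; [exact: measurable_L2s|exact: measurable_indic].
apply: filterS Sae => t St.
have Et : E t by rewrite /E /= -ge0_fin_numE.
have -> : (fun j => g j t) = (fun j => g' j t).
  by apply/funext => j; rewrite /g' indicE mem_set// mulr1.
exact: cg'.
Qed.

Lemma sq_integral_fatou (f : L2s) (g : nat -> L2s) (h : X -> R) (e : R) :
  measurable_fun setT h -> {ae mu, forall t, (fun j => g j t) @ \oo --> h t} ->
  (\forall j \near \oo, sq_integral (f - g j) <= e) ->
  (\int[mu]_x ((f x - h x) ^+ 2)%:E <= e%:E)%E.
Proof.
move=> mh gh ge.
pose q j t := (((f - g j) t) ^+ 2)%:E.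
have mq j : measurable_fun setT (q j).
  apply/measurable_EFinP; apply: measurable_funX; exact: measurable_L2s.
have q0 j t : (0 <= q j t)%E by rewrite lee_fin sqr_ge0.
have -> : (\int[mu]_x ((f x - h x) ^+ 2)%:E)%E =
    (\int[mu]_x limn_einf (q^~ x))%E.
  apply: ae_eq_integral => //.
  - apply/measurable_EFinP; apply: measurable_funX; apply: measurable_funB => //.
  - apply: measurableT_comp => //; apply: measurable_fun_limn_esup => j.
    exact: measurableT_comp.
  - apply: filterS gh => t gt _.
    have qt : q^~ t @ \oo --> ((f t - h t) ^+ 2)%:E.
      apply: cvg_EFin; first by apply: nearW.
      by apply: cvgM; apply: cvgB => //; exact: cvg_cst.
    by have [-> _] := cvg_limn_einf_sup qt.
apply: le_trans (fatou mu measurableT mq _) _ => //.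
rewrite limn_einf_lim; apply: lime_le; first exact: is_cvg_einfs.
case: ge => K _ KP; apply: nearW => k /=.
apply: (@le_trans _ _ (\int[mu]_x q (maxn k K) x)%E).
  by apply: ereal_inf_lbound; exists (maxn k K) => //=; exact: leq_maxl.
by rewrite -sq_integralE lee_fin; apply: KP; exact: leq_maxr.
Qed.

(** The Riesz-Fischer theorem: Fatou's lemma bounds the distance from a term to the
    pointwise limit of a rapidly converging subsequence by the Cauchy modulus. *)
Lemma L2s_complete (f : nat -> L2s) :
  (forall e, 0 < e -> exists K, forall i j, (K <= i)%N -> (K <= j)%N ->
     sq_integral (f i - f j) < e) ->
  exists h, forall e, 0 < e -> exists K, forall i, (K <= i)%N ->
     sq_integral (f i - h) < e.
Proof.
move=> fC.
have e_gt0 j : 0 < (4 ^+ j)^-1 / (2 ^ j.+1)%:R :> R.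
  by rewrite divr_gt0 ?invr_gt0 ?exprn_gt0// ltr0n expn_gt0.
have [K KP] := choice (fun j => fC _ (e_gt0 j)).
(* partial sums make the indices monotone; adding j makes them tend to infinity *)
pose n j := (\sum_(i < j.+1) K i)%N.
have nK j : (K j <= n j)%N by rewrite /n big_ord_recr leq_addl.
have nS j : (n j <= n j.+1)%N by rewrite /n [leqRHS]big_ord_recr leq_addr.
have [h [mh gh]] : exists h : X -> R, measurable_fun setT h /\
   {ae mu, forall t, (fun j => f (n j + j)%N t) @ \oo --> h t}.
  apply: (rapid_cauchy_cvg (g := fun j => f (n j + j)%N)) => j.
  apply: KP; first by rewrite (leq_trans (nK j))// (leq_trans (nS j))// leq_addr.
  by rewrite (leq_trans (nK j))// leq_addr.
have close e : 0 < e -> exists K, forall i, (K <= i)%N ->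
    (\int[mu]_x ((f i x - h x) ^+ 2)%:E <= e%:E)%E.
  move=> e0; have [K' K'P] := fC e e0; exists K' => i Ki.
  apply: (sq_integral_fatou mh gh); exists K' => // j /= Kj.
  by apply/ltW/K'P => //; rewrite (leq_trans Kj)// leq_addl.
have [i0 iP] := close 1 ltr01.
have hL : h \in Lfun mu 2%:E.
  have rL : (fun x => f i0 x - h x) \in Lfun mu 2%:E.
    apply: Lfun2_mem; last exact: le_lt_trans (iP i0 (leqnn _)) (ltry 1).
    by apply: measurable_funB => //; exact: measurable_L2s.
  rewrite (_ : h = (f i0 - Lfun_Sub (lee1n 2) rL : L2s)); first exact: LfunP.
  by apply/funext => x /=; rewrite opprB addrC subrK.
exists (Lfun_Sub (lee1n 2) hL) => e e0.
have [|K' K'P] := close (e / 2); first lra.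
exists K' => i /K'P; rewrite -lte_fin sq_integralE => /le_lt_trans; apply.
by rewrite lte_fin; lra.
Qed.

End LfunTwo.

Section L2space.
Variables (R : realType) (T : R) (m : nat).
Local Notation mu := (time_measure T).

Lemma integrable_L2s_mul (f g : LfunType mu (lee1n 2)) :
  mu.-integrable setT (fun t => (f t * g t)%:E).
Proof. by apply/Lfun1_integrable/(Lfun2_mul_Lfun1 (LfunP f) (LfunP g)). Qed.

Lemma L2dotE (u v : L2 T m) : L2dot u v = \sum_j \int[mu]_t (u j t * v j t).
Proof.
have int (r : seq 'I_m) :
    mu.-integrable setT (fun t => (\sum_(j <- r) u j t * v j t)%:E) /\
    \int[mu]_t (\sum_(j <- r) u j t * v j t) =
      \sum_(j <- r) \int[mu]_t (u j t * v j t).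
  elim: r => [|j r [IHi IH]].
    split; first by under eq_fun do rewrite big_nil; exact: integrable0.
    rewrite big_nil; under eq_Rintegral do rewrite big_nil.
    by rewrite Rintegral_cst// mul0r.
  split.
    under eq_fun do rewrite big_cons EFinD.
    by apply: integrableD => //; exact: integrable_L2s_mul.
  under eq_Rintegral do rewrite big_cons.
  by rewrite big_cons -IH RintegralD//; exact: integrable_L2s_mul.
rewrite /L2dot -(int _).2; apply: eq_Rintegral => t _.
by rewrite mxE; apply: eq_bigr => j _; rewrite !mxE.
Qed.

Lemma L2dot_sq (u : L2 T m) : L2dot u u = \sum_j sq_integral (u j).
Proof.
rewrite L2dotE; apply: eq_bigr => j _; apply: eq_Rintegral => t _.
by rewrite expr2.
Qed.

Lemma sq_integral_ge0 (f : LfunType mu (lee1n 2)) : 0 <= sq_integral f.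
Proof. by apply: Rintegral_ge0 => t _; exact: sqr_ge0. Qed.

Lemma L2dot_sip : semi_inner_product (@L2dot R T m).
Proof.
split.
- move=> a u v w; rewrite !L2dotE mulr_sumr -big_split /=; apply: eq_bigr => j _.
  rewrite -RintegralZl//; last exact: integrable_L2s_mul.
  rewrite -RintegralD//; first last.
  + exact: integrable_L2s_mul.
  + have := integrableZl measurableT a (integrable_L2s_mul (u j) (w j)).
    by congr integrable; apply/funext.
  by apply: eq_Rintegral => t _; rewrite !ffunE /= mulrDl mulrA.
- move=> u v; rewrite !L2dotE; apply: eq_bigr => j _.
  by apply: eq_Rintegral => t _; rewrite mulrC.
- by move=> u; rewrite L2dot_sq sumr_ge0// => j _; exact: sq_integral_ge0.
Qed.

Lemma L2dot_complete : sip_complete (@L2dot R T m).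
Proof.
move=> x xC.
have coord (j : 'I_m) : exists h, forall e, 0 < e ->
    exists K, forall i, (K <= i)%N -> sq_integral (x i j - h) < e.
  apply: L2s_complete => e /xC[K KP]; exists K => i i' Ki Ki'.
  apply: le_lt_trans (KP i i' Ki Ki'); rewrite L2dot_sq (bigD1 j)//= !ffunE.
  by rewrite lerDl sumr_ge0// => k _; exact: sq_integral_ge0.
have [h hP] := choice coord.
exists [ffun j => h j] => e e0.
have em0 : 0 < e / m.+1%:R by rewrite divr_gt0.
have [K KP] := choice (fun j => hP j _ em0).
exists (\sum_j K j)%N => i Ki; rewrite L2dot_sq.
apply: (@le_lt_trans _ _ (\sum_(j < m) e / m.+1%:R)).
  apply: ler_sum => j _; rewrite !ffunE; apply/ltW/KP.
  by apply: leq_trans Ki; rewrite (bigD1 j)//= leq_addr.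
rewrite sumr_const card_ord -[_ *+ m]mulr_natr mulrAC ltr_pdivrMr// ltr_pM2l//.
by rewrite ltr_nat.
Qed.

Lemma L2norm_lt (u : L2 T m) e : 0 < e -> (L2norm u < e) = (L2dot u u < e ^+ 2).
Proof.
move=> e0; have u0 := sip_ge0 L2dot_sip u.
rewrite -[in RHS](sqr_sqrtr u0) ltr_pXn2r// nnegrE ?sqrtr_ge0// ltW//.
Qed.

Lemma L2norm_le (u v : L2 T m) :
  (L2norm u <= L2norm v) = (L2dot u u <= L2dot v v).
Proof. by rewrite /L2norm ler_sqrt// (sip_ge0 L2dot_sip). Qed.

Lemma L2closed_sip (G : set (L2 T m)) : L2closed G -> sip_closed (@L2dot R T m) G.
Proof.
move=> Gcl u uG; apply: Gcl => e e0.
have [|g Gg gu] := uG (e ^+ 2); first by rewrite exprn_gt0.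
by exists g => //; rewrite L2norm_lt.
Qed.

Lemma convex_set_segment (G : set (L2 T m)) :
  convex_set (G : set (convex_lmodType (L2 T m))) -> segment_closed G.
Proof.
move=> Gcv a b t Ga Gb t0 t1.
have := Gcv a b (Itv01 t0 t1) (mem_set Ga) (mem_set Gb); rewrite inE.
by [].
Qed.
End L2space.

(** * The input map and the two kinds of projections *)

Section Kernel.
Variables (R : realType) (T : R).
Local Notation mu := (time_measure T).
Local Notation L2s := (LfunType mu (lee1n 2)).

(** The transition matrix is constrained only for times in [0, T]; precomposing
    with clamp extends its restriction to a Lipschitz function on the whole line,
    which is measurable. *)
Definition clamp (s : R) := Order.max 0 (Order.min s T).

Lemma clamp_id s : 0 <= s <= T -> clamp s = s.
Proof. by move=> /andP[s0 sT]; rewrite /clamp min_l// max_r. Qed.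

Lemma clamp_itv s : 0 <= T -> 0 <= clamp s <= T.
Proof. by move=> T0; rewrite le_max lexx ge_max T0 ge_min lexx orbT. Qed.

Lemma clamp_lip s t : `|clamp t - clamp s| <= `|t - s|.
Proof.
have h1 : t - s <= `|t - s| by exact: ler_norm.
have h2 : s - t <= `|t - s| by rewrite distrC ler_norm.
rewrite ler_norml /clamp; move: (`|t - s|) h1 h2 => r h1 h2.
case: (lerP s T) => ?; case: (lerP t T) => ?; case: (lerP 0 _) => ?;
  try case: (lerP 0 _) => ?; lra.
Qed.

Lemma lipschitz_measurable (f : R -> R) C :
  (forall s t, `|f t - f s| <= C * `|t - s|) ->
  measurable_fun setT (f : measurableTypeR R -> R).
Proof.
move=> fC; apply: continuous_measurable_fun => s.
apply/cvgrPdist_lt => e e0.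
have C0 : 0 < `|C| + 1 by rewrite ltr_wpDl.
near=> t; rewrite distrC; apply: le_lt_trans (fC s t) _.
apply: (@le_lt_trans _ _ ((`|C| + 1) * `|t - s|)).
  by rewrite ler_wpM2r// (le_trans (ler_norm C))// lerDl.
rewrite mulrC -ltr_pdivlMr// distrC.
near: t; exists (e / (`|C| + 1)) => //=.
by rewrite divr_gt0.
Unshelve. all: by end_near. Qed.

Lemma Lfun2_bounded_mul (c f : measurableTypeR R -> R) (M : R) :
  measurable_fun setT c -> (forall t, `|c t| <= M) ->
  f \in Lfun mu 2%:E -> (fun t => c t * f t) \in Lfun mu 2%:E.
Proof.
move=> mc cM fL.
have mf : measurable_fun setT f.
  by have := fL; rewrite inE => /andP[+ _]; rewrite inE.
have /integrableP[_ fi] := Lfun2_integrable_sqr fL.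
apply: Lfun2_mem; first exact: measurable_funM.
have M0 : 0 <= M by apply: le_trans (cM 0).
apply: (@le_lt_trans _ _ (\int[mu]_t ((M ^+ 2)%:E * `|(f t ^+ 2)%:E|))%E).
  apply: ge0_le_integral => //.
  - by move=> t _; rewrite lee_fin sqr_ge0.
  - by apply/measurable_EFinP; apply: measurable_funX; exact: measurable_funM.
  - apply: measurable_funeM => //; apply: measurableT_comp => //.
    by apply/measurable_EFinP; exact: measurable_funX.
  - move=> t _; rewrite -EFinM lee_fin exprMn ger0_norm ?sqr_ge0//.
    rewrite ler_wpM2r ?sqr_ge0// -[c t ^+ 2]real_normK ?num_real//.
    by rewrite lerXn2r// nnegrE.
rewrite ge0_integralZl_EFin ?sqr_ge0//; last first.
  by apply: measurableT_comp => //; apply/measurable_EFinP; exact: measurable_funX.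
by apply: lte_mul_pinfty => //; rewrite lee_fin sqr_ge0.
Qed.

Lemma L2s_sumE (I : finType) (f : I -> L2s) t : (\sum_i f i) t = \sum_i f i t.
Proof. by apply: (big_morph (fun g : L2s => g t)). Qed.

(** The j-th component of the input map is the pairing with the j-th row of
    Phi(T, s) B(s), which is square integrable as a bounded Lipschitz function
    times a square-integrable one. *)
Lemma input_map_kernel n m (A : R -> 'M[R]_n) (B : R -> 'M[R]_(n, m))
    (Phi : R -> R -> 'M[R]_n) : 0 <= T ->
  Linfty_mx T A -> L2_mx T B -> transition_matrix T A Phi ->
  exists K : 'I_n -> L2 T m, forall u j, input_map Phi B u j 0 = L2dot (K j) u.
Proof.
move=> T0 LA LB PhiA.
have [C C0 PhiC] := transition_lipschitz LA PhiA.
have clip j k s t : `|Phi T (clamp t) j k - Phi T (clamp s) j k| <= C * `|t - s|.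
  apply: le_trans (PhiC _ _ (clamp_itv s T0) (clamp_itv t T0) j k) _.
  by rewrite ler_wpM2l// clamp_lip.
have cb j k s : `|Phi T (clamp s) j k| <= `|Phi T 0 j k| + C * T.
  have := PhiC 0 (clamp s) _ (clamp_itv s T0) j k.
  rewrite subr0 lexx T0 => /(_ isT).
  have := ler_normD (Phi T (clamp s) j k - Phi T 0 j k) (Phi T 0 j k).
  rewrite subrK => h1 h2.
  have : C * `|clamp s| <= C * T.
    by have /andP[s0 sT] := clamp_itv s T0; rewrite ler_wpM2l// ger0_norm.
  by lra.
have hL j k l : (fun t => Phi T (clamp t) j k * B t k l) \in Lfun mu 2%:E.
  apply: Lfun2_bounded_mul (cb j k) (LB k l).
  exact: lipschitz_measurable (clip j k).
pose K j : L2 T m := [ffun l => \sum_k Lfun_Sub (lee1n 2) (hL j k l)].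
exists K => u j; rewrite mxE.
pose g t := ((L2val (K j) t)^T *m L2val u t) 0 0.
have -> : \int[mu]_(s in `[0, T]) (Phi T s *m B s *m L2val u s) j 0 =
    \int[mu]_(s in `[0, T]) g s.
  apply: eq_Rintegral => s; rewrite inE /= in_itv /= => sT.
  rewrite /g !mxE; apply: eq_bigr => l _; rewrite !mxE !ffunE L2s_sumE /=.
  by rewrite clamp_id.
rewrite /L2dot -/g /Rintegral; congr fine.
have gi : mu.-integrable setT (EFin \o g).
  have := @integrable_sum _ _ _ mu setT measurableT _ (index_enum 'I_m) predT
    (fun l t => ((K j) l t * u l t)%:E) (fun l _ => integrable_L2s_mul _ _).
  congr integrable; apply/funext => t.
  by rewrite sumEFin /g /= mxE; congr EFin; apply: eq_bigr => l _; rewrite !mxE.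
rewrite [RHS](@negligible_integral _ _ _ mu setT (~` `[0, T])) ?setTD ?setCK//.
- exact: measurableC.
- by rewrite /time_measure /= /mrestr setICl measure0.
Qed.
End Kernel.

Section MinimumEnergy.
Variables (R : realType) (T : R) (n m : nat).
Variables (L : L2 T m -> 'cV[R]_n) (K : 'I_n -> L2 T m).
Hypothesis LK : forall u j, L u j 0 = L2dot (K j) u.
Hypothesis Lctrl : controllable L.
Let dP := @L2dot_sip R T m.

Lemma cV_dotE (x y : 'cV[R]_n) : (x^T *m y) 0 0 = \sum_j x j 0 * y j 0.
Proof. by rewrite mxE; apply: eq_bigr => j _; rewrite mxE. Qed.

(** The adjoint sends y to sum_j y_j K_j, up to a null function. *)
Lemma adjointP u y : ((L u)^T *m y) 0 0 = L2dot u (adjoint L y).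
Proof.
have ex : exists v, forall u, ((L u)^T *m y) 0 0 = L2dot u v.
  exists (\sum_j y j 0 *: K j) => v.
  rewrite cV_dotE (sip_sym dP) (sip_suml dP); apply: eq_bigr => j _.
  by rewrite (sipZl dP) LK mulrC.
by have := xgetPex 0 ex; apply.
Qed.

Lemma input_mapB u v : L (u - v) = L u - L v.
Proof. by apply/colP => j; rewrite !mxE !LK (sipDr dP) (sipNr dP). Qed.

(** L L^* is the Gram matrix of the kernels. If it kills z then <L^* z, L^* z> = 0,
    so z is orthogonal to the range of L, which contains z itself; hence the
    matrix is invertible. *)
Lemma gram_invK y : L (adjoint L (gram_inv L y)) = y.
Proof.
pose W := \matrix_(i, j) L2dot (K j) (K i).
have LW z : L (adjoint L z) = W *m z.
  apply/colP => i; rewrite LK -adjointP cV_dotE mxE.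
  by apply: eq_bigr => j _; rewrite LK mxE.
have Wunit : W \in unitmx.
  rewrite -unitmx_tr -row_free_unit; apply: inj_row_free => v vW.
  pose z := v^T.
  have Wz : W *m z = 0 by rewrite -[W]trmxK -trmx_mul vW trmx0.
  have n0 : L2dot (adjoint L z) (adjoint L z) = 0.
    by rewrite -adjointP LW Wz trmx0 mul0mx mxE.
  have [u _ uz] : range L z by rewrite Lctrl.
  have := sip_null dP u n0; rewrite (sip_sym dP) -adjointP uz cV_dotE => z0.
  apply/rowP => j; rewrite mxE.
  have : z j 0 = 0; last by rewrite mxE.
  apply/eqP; rewrite -sqrf_eq0 eq_le sqr_ge0 andbT -z0 (bigD1 j)//= -expr2.
  by rewrite lerDl sumr_ge0// => k _; rewrite -expr2 sqr_ge0.
have := @pinvK _ _ (fun=> 0) setT (L \o adjoint L) y; apply.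
rewrite inE; exists (invmx W *m y) => //=.
by rewrite LW mulmxA mulmxV// mul1mx.
Qed.

(** The affine part of the iteration: the projection onto the controls u with
    L u = xi. *)
Definition correction (xi : 'cV[R]_n) (u : L2 T m) : L2 T m :=
  (u - adjoint L (gram_inv L (L u))) + adjoint L (gram_inv L xi).

Lemma correctionE xi u :
  correction xi u =
  u - (adjoint L (gram_inv L (L u)) - adjoint L (gram_inv L xi)).
Proof. by rewrite /correction opprB addrA addrAC. Qed.

Lemma correction_in xi u : L (correction xi u) = xi.
Proof. by rewrite correctionE !input_mapB !gram_invK opprB addrC subrK. Qed.

(** u - correction u lies in the range of L^*, hence is orthogonal to the kernel of
    L, which contains z - correction u. *)
Lemma correction_variational xi u z : L z = xi ->
  L2dot (u - correction xi u) (z - correction xi u) <= 0.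
Proof.
move=> Lz; rewrite [u - _](_ : _ =
  adjoint L (gram_inv L (L u)) - adjoint L (gram_inv L xi)); last first.
  by rewrite correctionE opprB addrC subrK.
rewrite (sip_sym dP) (sipDr dP) (sipNr dP) -!adjointP input_mapB correction_in Lz.
by rewrite subrr trmx0 !mul0mx subrr.
Qed.

Lemma input_map_null p u : L2dot (u - p) (u - p) = 0 -> L u = L p.
Proof.
move=> up0; apply/eqP; rewrite -subr_eq0 -input_mapB; apply/eqP/colP => j.
by rewrite LK mxE (sip_sym dP) (sip_null dP).
Qed.
End MinimumEnergy.

Section L2projection.
Variables (R : realType) (T : R) (m : nat) (G : set (L2 T m)).
Hypotheses (Gcl : L2closed G) (Gcv : segment_closed G) (G0 : G !=set0).

Lemma L2projP u : G (L2proj G u) /\ forall g, G g ->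
  L2dot (u - L2proj G u) (u - L2proj G u) <= L2dot (u - g) (u - g).
Proof.
have [p Gp pmin] := sip_nearest (@L2dot_sip R T m) (@L2dot_complete R T m) u
  (L2closed_sip Gcl) Gcv G0.
have ex : exists p, G p /\ forall g, G g -> L2norm (u - p) <= L2norm (u - g).
  by exists p; split=> [|g Gg]; [exact: Gp|rewrite L2norm_le; exact: pmin].
have [Gq qmin] := xgetPex 0 ex; split=> [|g Gg]; first exact: Gq.
by rewrite -L2norm_le; exact: qmin.
Qed.

Lemma L2closed_null p u : G p -> L2dot (u - p) (u - p) = 0 -> G u.
Proof.
move=> Gp up0; apply: Gcl => e e0; exists p => //.
by rewrite L2norm_lt// up0 exprn_gt0.
Qed.
End L2projection.

(** * Convergence of the constrained ensemble iteration *)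

Theorem corollary6 (R : realType) (T : R) (hT : 0 < T) (n m N : nat)
  (K : set R) (hK : compact K) (beta : 'I_N -> R) (hbeta : forall i, K (beta i))
  (A : R -> R -> 'M[R]_n) (B : R -> R -> 'M[R]_(n, m))
  (hA : forall i, Linfty_mx T (fun t => A t (beta i)))
  (hB : forall i, L2_mx T (fun t => B t (beta i)))
  (Phi : R -> R -> R -> 'M[R]_n)
  (hPhi : forall i, transition_matrix T (fun t => A t (beta i))
                      (fun t s => Phi t s (beta i)))
  (X0 XF : R -> 'cV[R]_n)
  (L : 'I_N -> L2 T m -> 'cV[R]_n)
  (hL : forall i, L i = input_map (fun t s => Phi t s (beta i))
                                  (fun t => B t (beta i)))
  (xi : 'I_N -> 'cV[R]_n)
  (hxi : forall i, xi i = XF (beta i) - Phi T 0 (beta i) *m X0 (beta i))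
  (hctrl : forall i, controllable (L i))
  (G : set (L2 T m)) (hGcl : L2closed G)
  (hGcv : convex_set (G : set (convex_lmodType (L2 T m))))
  (C : 'I_N -> set (L2 T m)) (hC : forall i, C i = [set u | L i u = xi i])
  (lambda : 'I_N.+1 -> R) (hlambda : forall i, 0 < lambda i < 1)
  (hsum : \sum_i lambda i = 1)
  (hne : (\bigcap_i C i) `&` G !=set0)
  (u0 : L2 T m) (u : nat -> L2 T m) (hu0 : u 0%N = u0)
  (hu : forall k, u k.+1 =
     lambda ord0 *: L2proj G (u k)
     + \sum_(i < N) lambda (lift ord0 i) *:
         ((u k - adjoint (L i) (gram_inv (L i) (L i (u k))))
          + adjoint (L i) (gram_inv (L i) (xi i)))) :
  exists2 ustar, ((\bigcap_i C i) `&` G) ustar & L2weak_cvg u ustar.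
Proof.
have [z [zC zG]] := hne.
have kernel i : exists K : 'I_n -> L2 T m, forall u j, L i u j 0 = L2dot (K j) u.
  by rewrite hL; exact: input_map_kernel (ltW hT) (hA i) (hB i) (hPhi i).
have [Ker LK] := choice kernel.
have Gcv := convex_set_segment hGcv.
have G0 : G !=set0 by exists z.
pose D (k : 'I_N.+1) := if unlift ord0 k is Some i then C i else G.
pose P (k : 'I_N.+1) := if unlift ord0 k is Some i then
  correction (L i) (xi i) else L2proj G.
have D_in k v : D k (P k v).
  rewrite /D /P; case: (unlift ord0 k) => [i|].
    by rewrite hC; exact: (correction_in (LK i) (hctrl i)).
  by have [] := L2projP hGcl Gcv G0 v.
have P_var k v w : D k w -> L2dot (v - P k v) (w - P k v) <= 0.
  rewrite /D /P; case: (unlift ord0 k) => [i|].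
    by rewrite hC; exact: (correction_variational (LK i) (hctrl i)).
  have [Gp pmin] := L2projP hGcl Gcv G0 v.
  exact: (nearest_variational (@L2dot_sip R T m) Gcv Gp pmin).
have D_null k p v : D k p -> L2dot (v - p) (v - p) = 0 -> D k v.
  rewrite /D; case: (unlift ord0 k) => [i|]; last exact: L2closed_null.
  by rewrite hC => Lp /(input_map_null (LK i)); rewrite /= Lp.
have lambda_gt0 k : 0 < lambda k by have /andP[] := hlambda k.
have uS k : u k.+1 = \sum_i lambda i *: P i (u k).
  rewrite hu big_ord_recl /P unlift_none; congr (_ + _).
  by apply: eq_bigr => i _; rewrite liftK.
have Dz k : D k z by rewrite /D; case: (unlift ord0 k) => [i|//]; exact: zC.
have [y Dy uy] := averaged_projections_weak_cvg (@L2dot_sip R T m)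
  (@L2dot_complete R T m) D_in P_var D_null lambda_gt0 hsum uS Dz.
exists y => //; split.
  by move=> i _; have := Dy (lift ord0 i); rewrite /D liftK.
by have := Dy ord0; rewrite /D unlift_none.
Qed.
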